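(* Let $p$ be a prime, let $E$ be an elementary abelian $p$-group of order $q$, let $\Bbbk$ be an infinite field of characteristic $p$, and let $W$ be a faithful indecomposable $\Bbbk E$-module of dimension $2$. Let $V=S^m(W)$, where $m$ is a nonnegative integer with $m<p$. Then the algebra of invariants $\Bbbk[V]^E$ is generated as a $\Bbbk$-algebra by invariants of degree $\leq 2q-3$.
   Context: $S^m(W)$ denotes the $m$-th symmetric power of $W$ with its usual $E$-action. $\Bbbk[V]$ is the $\Bbbk$-algebra of polynomial functions $V\to\Bbbk$, identified (as $\Bbbk$ is infinite) with the symmetric algebra $S(V^* )$, graded by total degree, with action $(\sigma f)(v)=f(\sigma^{-1}v)$. $\Bbbk[V]^E$ is the subalgebra of $E$-fixed polynomials.
   Formalization: The case q = 2, m = 1 is excluded, because the claim is false there: for the group of order 2 acting on V = W by a shear in characteristic 2, the invariants k[x, y(y+x)] need a generator of degree 2, while 2q-3 = 1. *)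

(* Defs.v *)
From mathcomp Require Export all_boot all_algebra all_fingroup abelian
  mxrepresentation.
From mathcomp.multinomials Require Export mpoly.

Set Implicit Arguments.
Unset Strict Implicit.
Unset Printing Implicit Defensive.

Import GRing.Theory.
Local Open Scope ring_scope.

Section Modules.

Variables (k : fieldType) (gT : finGroupType) (G : {group gT}).

(* As everywhere in mxrepresentation, rG : mx_representation k G n makes
   'rV[k]_n a G-module through v |-> v *m rG g, and submodules are row spaces.
   This is formally a right action. It is only used below for abelian G, where
   left and right modules agree. *)

Definition mx_indecomposable n (rG : mx_representation k G n) : Prop :=
  (0 < n)%N /\
  forall U1 U2 : 'M[k]_n, mxmodule rG U1 -> mxmodule rG U2 ->
    (U1 + U2 :=: 1%:M)%MS -> (U1 :&: U2)%MS = 0 -> U1 = 0 \/ U2 = 0.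

(* 'X_i |-> \sum_j A i j *: 'X_j *)
Definition lin_subst n (A : 'M[k]_n) (f : {mpoly k[n]}) : {mpoly k[n]} :=
  f \mPo [tuple \sum_(j < n) A i j *: 'X_j | i < n].

Lemma lin_subst_meval n (A : 'M[k]_n) f (v : 'rV[k]_n) :
  (lin_subst A f).@[v 0] = f.@[(v *m A^T) 0].
Proof.
rewrite comp_mpoly_meval; apply: meval_eq => i.
rewrite tnth_mktuple raddf_sum /= mxE; apply: eq_bigr => j _.
by rewrite mevalZ mevalXU mxE mulrC.
Qed.

Lemma lin_substM n (A B : 'M[k]_n) f :
  lin_subst (A *m B) f = lin_subst B (lin_subst A f).
Proof.
rewrite /lin_subst [LHS]comp_mpolyEX [f \mPo _]comp_mpolyEX raddf_sum /=.
apply: eq_bigr => m _.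
rewrite !comp_mpolyZ !comp_mpolyX rmorph_prod; congr (_ *: _).
apply: eq_bigr => i _; rewrite rmorphXn !tnth_mktuple raddf_sum /=.
congr (_ ^+ _).
rewrite [RHS](eq_bigr (fun j => \sum_l (A i j * B j l) *: 'X_l)) => [|j _].
  rewrite exchange_big /=; apply: eq_bigr => l _.
  by rewrite mxE scaler_suml.
rewrite comp_mpolyZ comp_mpolyXU -tnth_nth tnth_mktuple scaler_sumr.
by apply: eq_bigr => l _; rewrite scalerA.
Qed.

Lemma lin_subst1 n (f : {mpoly k[n]}) : lin_subst 1%:M f = f.
Proof.
rewrite -[RHS]comp_mpoly_id /lin_subst; congr (_ \mPo _).
apply: eq_from_tnth => i; rewrite !tnth_mktuple (bigD1 i) //= mxE eqxx scale1r.
by rewrite big1 ?addr0 // => j ne; rewrite mxE eq_sym (negPf ne) scale0r.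
Qed.

Lemma lin_subst_homog n (A : 'M[k]_n) d f :
  f \is d.-homog -> lin_subst A f \is d.-homog.
Proof.
move=> hf; rewrite /lin_subst comp_mpolyE big_seq.
apply: rpred_sum => u uf; apply: rpredZ.
rewrite -(dhomog_mf hf uf : mdeg u = d) mdegE.
elim/big_rec2: _ => [|i d' g _ hg]; first exact: dhomog1.
apply: dhomogM => //; rewrite -[X in X.-homog]mul1n; apply: dhomogMn.
rewrite tnth_mktuple; apply: rpred_sum => j _; apply: rpredZ.
by rewrite dhomogX /= mdeg1.
Qed.

End Modules.

Section SymmetricPower.

Variables (k : fieldType) (gT : finGroupType) (G : {group gT}) (m : nat).

(* S(W) = k[X_0, X_1] with X_0, X_1 the standard basis of W = k^2, and S^m(W)
   is its component of degree m, with basis X_0^(m-i) X_1^i for 0 <= i <= m. *)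

Definition sym_mon (i : 'I_m.+1) : 'X_{1..2} :=
  [multinom if j == ord0 then m - i else i | j < 2].

Lemma sym_mon_mdeg i : mdeg (sym_mon i) = m.
Proof.
by rewrite mdegE !big_ord_recl big_ord0 !mnmE /= addn0 subnK // -ltnS.
Qed.

Lemma sym_monP (u : 'X_{1..2}) (i : 'I_m.+1) :
  mdeg u = m -> (u == sym_mon i) = (u ord_max == i :> nat).
Proof.
rewrite mdegE !big_ord_recl big_ord0 addn0 => hu.
have e1 : lift ord0 ord0 = ord_max :> 'I_2 by apply: val_inj.
have {}hu : (u ord0 + u ord_max = m)%N by rewrite -e1.
apply/eqP/eqP => [-> | ui]; first by rewrite mnmE.
apply/mnmP => j; rewrite mnmE; case: eqP => [-> | /eqP j0].
  by rewrite -ui -hu addnK.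
by rewrite -ui; congr (u _); apply: val_inj; case: j j0 => [[|[|]]].
Qed.

Lemma sym_monE (f : {mpoly k[2]}) :
  f \is m.-homog -> f = \sum_(i < m.+1) f@_(sym_mon i) *: 'X_[sym_mon i].
Proof.
move=> hf; apply/mpolyP => u; rewrite raddf_sum /=.
have [um | um] := eqVneq (mdeg u) m; last first.
  rewrite (dhomog_nemf_coeff hf um) big1 // => i _.
  rewrite mcoeffZ mcoeffX; case: eqP => [ui|_]; last by rewrite mulr0.
  by rewrite -ui sym_mon_mdeg eqxx in um.
have u1 : (u ord_max < m.+1)%N.
  rewrite ltnS -um mdegE (bigD1 ord_max) //=; exact: leq_addr.
have uE : u = sym_mon (Ordinal u1) by apply/eqP; rewrite sym_monP.
rewrite (bigD1 (Ordinal u1)) //= mcoeffZ mcoeffX -uE eqxx mulr1.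
rewrite big1 ?addr0 // => i ne; rewrite mcoeffZ mcoeffX eq_sym sym_monP //.
case: eqP => [e|_]; last by rewrite mulr0.
by case/eqP: ne; apply: val_inj.
Qed.

Variable rW : mx_representation k G 2.

(* Row i holds the coordinates of the image of X_0^(m-i) X_1^i. *)
Definition sym_power_mx (g : gT) : 'M[k]_m.+1 :=
  \matrix_(i, j) (lin_subst (rW g) 'X_[sym_mon i])@_(sym_mon j).

Lemma sym_power_mx_row g i :
  \sum_j sym_power_mx g i j *: 'X_[sym_mon j] =
    lin_subst (rW g) 'X_[sym_mon i].
Proof.
rewrite [RHS]sym_monE; last by rewrite lin_subst_homog // dhomogX /= sym_mon_mdeg.
by apply: eq_bigr => j _; rewrite mxE.
Qed.

Lemma sym_power_mx_repr : mx_repr G sym_power_mx.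
Proof.
split=> [|g h Gg Gh]; apply/matrixP => i j; rewrite !mxE.
  rewrite repr_mx1 lin_subst1 mcoeffX sym_monP ?sym_mon_mdeg // mnmE /=.
  by congr (_ %:R).
rewrite repr_mxM // lin_substM -sym_power_mx_row.
rewrite {1}/lin_subst (raddf_sum (comp_mpoly _)) raddf_sum /=; apply: eq_bigr => l _.
by rewrite comp_mpolyZ mcoeffZ; congr (_ * _); rewrite mxE.
Qed.

Definition sym_power : mx_representation k G m.+1 :=
  MxRepresentation sym_power_mx_repr.

End SymmetricPower.

Section Invariants.

Variables (k : fieldType) (gT : finGroupType) (G : {group gT}) (n : nat).
Variable rV : mx_representation k G n.

(* {mpoly k[n]} is k[V] for V = 'rV[k]_n, 'X_i being the i-th coordinate
   function. Polynomials and polynomial functions agree when k is infinite, and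
   poly_actE then says that (g f)(v) = f(g^-1 v). *)
Definition poly_act (g : gT) (f : {mpoly k[n]}) : {mpoly k[n]} :=
  lin_subst (rV g^-1%g)^T f.

Lemma poly_actE g f (v : 'rV[k]_n) :
  (poly_act g f).@[v 0] = f.@[(v *m rV g^-1%g) 0].
Proof. by rewrite lin_subst_meval trmxK. Qed.

Definition invariant (f : {mpoly k[n]}) : Prop :=
  forall g, g \in G -> poly_act g f = f.

Definition invariant_deg_le (d : nat) (f : {mpoly k[n]}) : Prop :=
  invariant f /\ (msize f <= d.+1)%N.

End Invariants.

Section Generation.

Variables (k : fieldType) (A : algType k).

Inductive in_alg_span (S : A -> Prop) : A -> Prop :=
| AlgSpanGen x : S x -> in_alg_span S x
| AlgSpanScalar c : in_alg_span S c%:A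
| AlgSpanAdd x y :
    in_alg_span S x -> in_alg_span S y -> in_alg_span S (x + y)
| AlgSpanMul x y :
    in_alg_span S x -> in_alg_span S y -> in_alg_span S (x * y).

Definition generated_as_algebra (B S : A -> Prop) : Prop :=
  forall x, B x <-> in_alg_span S x.

End Generation.

(* Main.v *)
From HB Require Import structures.
Require Import Defs.
From mathcomp Require Import ring zify.
From mathcomp Require Import pgroup mxabelem.
From mathcomp.multinomials Require Import ssrcomplements.

(** After a change of basis of W, every g in E acts as the shear fixing X_0 and
    sending X_1 to X_1 + a(g) X_0, where a is an injective additive map from E
    to k (unipotent_form). On k[V] = k[X_0, ..., X_m] this becomes
    X_i |-> sum_j C(j, i) (- a(g))^(j - i) X_j; so X_m is fixed and X_0 is the
    variable at the top of the flag. Put q = #|E|.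

    Degree d polynomials in the coefficients of a binary form of degree m are
    the symmetric polynomials in its m roots of degree at most d in each root
    (root_eval_inj, root_eval_surj), and E acts by translating all the roots by
    the same a(g) (root_eval_act). This makes the structure of the action
    visible. In one variable y, let L be the product of the y - a(g). A
    polynomial is L times its quotient by L plus its remainder, and Lagrange
    interpolation writes the remainder as a sum over E of conjugates of one
    linear operator (sum_spike). Doing this in each of the m roots, and
    telescoping, writes every invariant symmetric polynomial as
    L(y_1) ... L(y_m) G plus a trace; averaging over the symmetric group, which
    is possible because m < p, makes everything symmetric
    (symmetric_trace_decomposition). Back in k[V], every invariant of degree
    d >= q is N g + tr(h), where N is the norm of X_0, of degree q, g is an
    invariant of degree d - q and h has degree d (fixed_norm_trace).

    It remains to decompose tr(h) when d >= 2q - 2. Let J be the ideal of k[V]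
    generated by the homogeneous invariants of degree between 1 and q. For
    linear forms u_g, g <> 1, the product of the g(u_g) - u_g lies in J: it is
    the sum over b in E of the products over g of g(u_g) - b(u_g), since the
    term of b <> 1 has a zero factor, and expanding the products exhibits that
    sum as a combination of traces of products of fewer than q of the u_g
    (prod_diff_in_hilbert_ideal). Each of X_1, ..., X_m has the form g(u) - u
    (var_in_range), so J contains all products of q - 1 of them. Together with
    the norm, which is X_0^q modulo X_1, ..., X_m, this puts all monomials of
    degree at least 2q - 2 in J: one with few factors X_0 has q - 1 others
    (list_in_hilbert_ideal). So h is a sum of c f with c invariant of degree
    between 1 and q, and tr(c f) = c tr(f) is a product of invariants of lower
    degree. Induction on the degree concludes (homog_fixed_generated).

    The induction uses q < 2q - 2, that is q >= 3. When q = 2, also p = 2 and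
    only m = 0 is left, where k[V] is a polynomial ring in one variable. *)

Set Implicit Arguments.
Unset Strict Implicit.
Unset Printing Implicit Defensive.

Import GRing.Theory.
Local Open Scope ring_scope.

(** * Interpolation on a finite additive subgroup *)

Section Interpolation.

Variables (k : fieldType) (gT : finGroupType) (E : {group gT}) (a : gT -> k).
Hypothesis aM : {in E &, {morph a : g h / (g * h)%g >-> g + h}}.
Hypothesis a_inj : {in E &, injective a}.

Lemma additive_char1 : a 1%g = 0.
Proof. by apply: (addrI (a 1%g)); rewrite -aM // mulg1 addr0. Qed.

Lemma additive_charV g : g \in E -> a g^-1%g = - a g.
Proof.
by move=> Eg; apply: (addrI (a g)); rewrite -aM ?groupV // mulgV subrr additive_char1.
Qed.

Lemma additive_char_eq0 g : g \in E -> (a g == 0) = (g == 1%g).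
Proof. by move=> Eg; rewrite -additive_char1 (inj_in_eq a_inj). Qed.

Definition translate (c : k) (p : {poly k}) : {poly k} := p \Po ('X - c%:P).

HB.instance Definition _ c :=
  GRing.LRMorphism.copy (translate c) (comp_poly ('X - c%:P)).

Lemma translateX c : translate c 'X = 'X - c%:P.
Proof. exact: comp_polyX. Qed.

Lemma translateC c b : translate c b%:P = b%:P.
Proof. exact: comp_polyC. Qed.

Lemma translateD c d p : translate c (translate d p) = translate (c + d) p.
Proof.
rewrite /translate -comp_polyA; congr (_ \Po _).
by rewrite comp_polyB comp_polyX comp_polyC polyCD opprD addrA.
Qed.

Lemma translate0 p : translate 0 p = p.
Proof. by rewrite /translate subr0 comp_polyXr. Qed.

Lemma horner_translate c p x : (translate c p).[x] = p.[x - c].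
Proof. by rewrite horner_comp !hornerE. Qed.

Lemma size_translate c p : size (translate c p) = size p.
Proof. by rewrite size_comp_poly2 // size_XsubC. Qed.

Definition vanishing : {poly k} := \prod_(g in E) ('X - (a g)%:P).

(** Lagrange interpolation polynomial of the point 0 = a 1 of a(E). *)
Definition delta : {poly k} :=
  (\prod_(g in (E^#)%g) (0 - a g))^-1 *: \prod_(g in (E^#)%g) ('X - (a g)%:P).

(** Its conjugates by the translations of a(E) add up to the interpolation of p
    on a(E). *)
Definition spike (p : {poly k}) : {poly k} := p.[0] *: delta.

Fact spike_is_linear : linear spike.
Proof. by move=> c p r; rewrite /spike !hornerE scalerDl scalerA. Qed.

HB.instance Definition _ :=
  GRing.isLinear.Build k {poly k} {poly k} _ spike spike_is_linear.

Lemma size_vanishing : size vanishing = #|E|.+1.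
Proof. by rewrite /vanishing -big_enum size_prod_XsubC -cardE. Qed.

Lemma vanishing_monic : vanishing \is monic.
Proof. by rewrite /vanishing -big_enum monic_prod_XsubC. Qed.

Lemma vanishing_neq0 : vanishing != 0.
Proof. exact: monic_neq0 vanishing_monic. Qed.

Lemma sum_translate_group (V : nmodType) h (F : k -> V) : h \in E ->
  \sum_(g in E) F (a g) = \sum_(g in E) F (a h + a g).
Proof.
move=> Eh; rewrite (reindex_inj (mulgI h)) /=.
by apply: eq_big => [g | g Eg]; rewrite ?groupMl // aM // -(groupMl g Eh).
Qed.

Lemma translate_vanishing g : g \in E -> translate (a g) vanishing = vanishing.
Proof.
move=> Eg; rewrite /vanishing rmorph_prod /= [RHS](reindex_inj (mulgI g)) /=.
apply: eq_big => [h | h Eh]; rewrite ?groupMl // aM //.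
by rewrite rmorphB /= translateX translateC polyCD opprD addrA.
Qed.

Lemma size_delta : (size delta <= #|E|)%N.
Proof.
apply: leq_trans (size_scale_leq _ _) _.
by rewrite -big_enum size_prod_XsubC -cardE (cardsD1 1%g E) group1.
Qed.

Lemma horner_delta g : g \in E -> delta.[a g] = (g == 1%g)%:R.
Proof.
move=> Eg; rewrite hornerZ horner_prod.
have [-> | g1] := eqVneq g 1%g.
  rewrite [X in _ * X](eq_bigr (fun h => 0 - a h)) => [|h _].
    rewrite mulVf // prodf_seq_neq0; apply/allP => h _; apply/implyP.
    by rewrite in_setD1 => /andP[h1 Eh]; rewrite sub0r oppr_eq0 additive_char_eq0.
  by rewrite hornerXsubC additive_char1.
by rewrite [X in _ * X](bigD1 g) ?in_setD1 ?g1 //= hornerXsubC subrr mul0r mulr0.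
Qed.

(** The right-hand side takes the values of p on the #|E| points of a(E) and
    has degree less than #|E|, so it is the remainder of p modulo vanishing.
    The projection onto remainders is thus a relative trace from the trivial
    group, as it must be because the polynomials of degree less than #|E| form
    a free module of rank one over the group ring. *)
Lemma sum_spike p : p - vanishing * (p %/ vanishing) =
  \sum_(g in E) translate (a g) (spike (translate (- a g) p)).
Proof.
rewrite [X in X - _](divp_eq p vanishing) mulrC addrC addKr.
set r := RHS.
have szr : (size r <= #|E|)%N.
  apply: leq_trans (size_sum _ _ _) _; apply/bigmax_leqP => g _.
  by rewrite size_translate (leq_trans (size_scale_leq _ _)) ?size_delta.
have rE h : h \in E -> r.[a h] = p.[a h].
  move=> Eh; rewrite horner_sum (bigD1 h) //= big1 => [|g /andP[Eg gh]].
    rewrite horner_translate subrr /spike hornerZ.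
    rewrite -{2}additive_char1 horner_delta // eqxx mulr1 addr0.
    by rewrite horner_translate sub0r opprK.
  rewrite horner_translate hornerZ -additive_charV // -aM ?groupV //.
  by rewrite horner_delta ?groupM ?groupV // -eq_mulgV1 eq_sym (negPf gh) mulr0.
have rtE h : h \in E -> root vanishing (a h).
  by move=> Eh; rewrite /root horner_prod (bigD1 h) //= hornerXsubC subrr mul0r.
apply/eqP; rewrite -subr_eq0; apply/eqP.
apply: (@roots_geq_poly_eq0 _ _ [seq a g | g <- enum E]).
- apply/allP => x /mapP[g]; rewrite mem_enum => Eg ->.
  rewrite /root hornerD hornerN rE // [in X in _ - X](divp_eq p vanishing).
  by rewrite hornerD hornerM (rootP (rtE _ Eg)) mulr0 add0r subrr.
- rewrite map_inj_in_uniq ?enum_uniq // => g h; rewrite !mem_enum; exact: a_inj.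
rewrite size_map -cardE; apply: leq_trans (size_polyD _ _) _.
rewrite geq_max size_polyN szr andbT -ltnS -size_vanishing.
by rewrite ltn_modp vanishing_neq0.
Qed.

Lemma translate_divp g p : g \in E ->
  translate (a g) (p %/ vanishing) = translate (a g) p %/ vanishing.
Proof.
move=> Eg; rewrite {2}[p](divp_eq p vanishing) rmorphD rmorphM /=.
rewrite translate_vanishing // divp_addl_mul_small //.
by rewrite size_translate ltn_modp vanishing_neq0.
Qed.

End Interpolation.

(** * Operators acting variable by variable, and multidegree bounds *)

Section TensorOperators.

Variables (k : fieldType) (m : nat).
Implicit Types (F G : {mpoly k[m]}) (p v : 'I_m -> {poly k}) (mu : 'X_{1..m}).

Definition in_var (j : 'I_m) : {poly k} -> {mpoly k[m]} := horner_alg 'X_j.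

HB.instance Definition _ j :=
  GRing.RMorphism.copy (in_var j) (horner_alg ('X_j : {mpoly k[m]})).

(** horner_alg comes with linearity for multiplication by c%:A only; scaling
    by c is what multilinearity of pure_tensor needs. *)
Fact in_var_is_scalable j : scalable (in_var j).
Proof. by move=> c r; rewrite /in_var linearZ /= mulr_algl. Qed.

HB.instance Definition _ j :=
  GRing.isScalable.Build k {poly k} {mpoly k[m]} _ (in_var j)
    (in_var_is_scalable j).

Definition pure_tensor p : {mpoly k[m]} := \prod_j in_var j (p j).

Lemma in_varX j : in_var j 'X = 'X_j.
Proof. exact: horner_algX. Qed.

Lemma in_varC j c : in_var j c%:P = c%:MP.
Proof. by rewrite /in_var horner_algC alg_mpolyC. Qed.

Lemma mpolyX_pure mu : 'X_[mu] = pure_tensor (fun j => 'X^(mu j)).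
Proof.
by rewrite mpolyXE_id; apply: eq_bigr => j _; rewrite rmorphXn /= in_varX.
Qed.

Lemma pure_sum n (c : 'I_m -> 'I_n -> k) (v : 'I_m -> 'I_n -> {poly k}) :
  pure_tensor (fun j => \sum_i c j i *: v j i) =
  \sum_(f : {ffun 'I_m -> 'I_n})
    (\prod_j c j (f j)) *: pure_tensor (fun j => v j (f j)).
Proof.
rewrite /pure_tensor (eq_bigr (fun j => \sum_i c j i *: in_var j (v j i))) => [|j _].
  by rewrite bigA_distr_bigA; apply: eq_bigr => f _; rewrite scaler_prod.
by rewrite linear_sum; apply: eq_bigr => i _; rewrite linearZ.
Qed.

(** Seeing {mpoly k[m]} as the m-th tensor power of {poly k}, this is the
    tensor product of the operators u j, defined on the basis of monomials. *)
Definition tensor_op (u : 'I_m -> {linear {poly k} -> {poly k}}) F : {mpoly k[m]} :=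
  \sum_(mu <- msupp F) F@_mu *: pure_tensor (fun j => u j 'X^(mu j)).

(** An index set that does not depend on F makes linearity visible. *)
Lemma tensor_opE u n F : (msize F <= n)%N ->
  tensor_op u F =
  \sum_(mu : 'X_{1..m < n}) F@_mu *: pure_tensor (fun j => u j 'X^(mu j)).
Proof.
pose I : subFinType _ := 'X_{1..m < n}.
move=> le_F_n; rewrite /tensor_op (big_mksub I) /=; first last.
- by move=> x /msize_mdeg_lt /leq_trans; apply.
- by rewrite msupp_uniq.
rewrite big_rmcond //= => i /memN_msupp_eq0 ->.
by rewrite scale0r.
Qed.

Fact tensor_op_is_linear u : linear (tensor_op u).
Proof.
move=> c F G; pose n := maxn (msize (c *: F + G)) (maxn (msize F) (msize G)).
rewrite !(@tensor_opE u n) ?leq_max ?leqnn ?orbT // scaler_sumr -big_split /=.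
by apply: eq_bigr => mu _; rewrite mcoeffD mcoeffZ scalerDl scalerA.
Qed.

HB.instance Definition _ u :=
  GRing.isLinear.Build k {mpoly k[m]} {mpoly k[m]} _ (tensor_op u) (tensor_op_is_linear u).

Lemma tensor_opX u mu : tensor_op u 'X_[mu] = pure_tensor (fun j => u j 'X^(mu j)).
Proof. by rewrite /tensor_op msuppX big_seq1 mcoeffX eqxx scale1r. Qed.

Lemma eq_pure p v : p =1 v -> pure_tensor p = pure_tensor v.
Proof. by move=> e; apply: eq_bigr => j _; rewrite e. Qed.

Lemma poly_expand n (r : {poly k}) : (size r <= n)%N ->
  r = \sum_(i < n) r`_i *: 'X^i.
Proof.
move=> szr; rewrite -poly_def; apply/polyP => i; rewrite coef_poly.
by case: ltnP => // /(leq_trans szr)/leq_sizeP->.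
Qed.

Lemma tensor_op_pure u p : tensor_op u (pure_tensor p) = pure_tensor (fun j => u j (p j)).
Proof.
pose n := (\max_j size (p j))%N.
have pE j : p j = \sum_(i < n) (p j)`_i *: 'X^i.
  by apply: poly_expand; apply: (leq_bigmax j).
rewrite (eq_pure pE) pure_sum linear_sum /=.
have upE j : u j (p j) = \sum_(i < n) (p j)`_i *: u j 'X^i.
  by rewrite {1}(pE j) linear_sum; apply: eq_bigr => i _; rewrite linearZ.
rewrite (eq_pure upE) pure_sum; apply: eq_bigr => f _; rewrite linearZ /=.
congr (_ *: _).
have -> : pure_tensor (fun j => 'X^(f j)) = 'X_[[multinom (f j : nat) | j < m]].
  by rewrite mpolyX_pure; apply: eq_pure => j; rewrite mnmE.
by rewrite tensor_opX; apply: eq_pure => j; rewrite mnmE.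
Qed.

Lemma pure_ind (P : {mpoly k[m]} -> Prop) :
  P 0 -> (forall c p F, P F -> P (c *: pure_tensor p + F)) -> forall F, P F.
Proof.
move=> P0 PD; elim/mpolyind => // c mu F _ _ PF.
by rewrite mpolyX_pure; apply: PD.
Qed.

Lemma linear_pure_eq (V : lmodType k) (A B : {linear {mpoly k[m]} -> V}) :
  (forall p, A (pure_tensor p) = B (pure_tensor p)) -> A =1 B.
Proof.
move=> eAB; elim/pure_ind => [|c p F IH]; first by rewrite !linear0.
by rewrite !linearP eAB IH.
Qed.

Definition shift (c : k) : {mpoly k[m]} -> {mpoly k[m]} :=
  comp_mpoly [tuple 'X_j - c%:MP | j < m].

HB.instance Definition _ c := GRing.LRMorphism.copy (shift c)
  (comp_mpoly [tuple ('X_j - c%:MP : {mpoly k[m]}) | j < m]).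

Lemma shiftXU c j : shift c 'X_j = 'X_j - c%:MP.
Proof. by rewrite /shift comp_mpolyXU -tnth_nth tnth_mktuple. Qed.

Lemma shift_in_var c j r : shift c (in_var j r) = in_var j (translate c r).
Proof.
elim/poly_ind: r => [|r b IH]; first by rewrite !rmorph0.
rewrite !rmorphD !rmorphM /= {}IH in_varX shiftXU.
rewrite translateX translateC rmorphB /= in_varX !in_varC.
by rewrite /shift comp_mpolyC.
Qed.

Lemma shift_pure c p : shift c (pure_tensor p) = pure_tensor (fun j => translate c (p j)).
Proof. by rewrite rmorph_prod; apply: eq_bigr => j _; apply: shift_in_var. Qed.

Lemma shiftD c d F : shift c (shift d F) = shift (c + d) F.
Proof.
apply: (@linear_pure_eq _ (shift c \o shift d) (shift (c + d))) => p /=.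
by rewrite !shift_pure; apply: eq_pure => j; rewrite translateD.
Qed.

Lemma shift0 F : shift 0 F = F.
Proof.
apply: (@linear_pure_eq _ (shift 0) idfun) => p /=.
by rewrite !shift_pure; apply: eq_pure => j; rewrite translate0.
Qed.

Lemma msym_in_var (s : 'S_m) j r : msym s (in_var j r) = in_var (s j) r.
Proof.
elim/poly_ind: r => [|r b IH]; first by rewrite !rmorph0.
rewrite !rmorphD !rmorphM /= {}IH !in_varX !in_varC.
by rewrite /msym mmapX mmap1U mmapC.
Qed.

Lemma msym_pure (s : 'S_m) p :
  msym s (pure_tensor p) = pure_tensor (fun j => p (s^-1 j)%g).
Proof.
rewrite rmorph_prod [RHS](reindex_inj (@perm_inj _ s)) /=.
by apply: eq_bigr => j _; rewrite permK; apply: msym_in_var.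
Qed.

Lemma msym_tensor_op (u : {linear {poly k} -> {poly k}}) s F :
  msym s (tensor_op (fun=> u) F) = tensor_op (fun=> u) (msym s F).
Proof.
apply: (@linear_pure_eq _ (msym s \o tensor_op (fun=> u))
  (tensor_op (fun=> u) \o msym s)).
by move=> p /=; rewrite tensor_op_pure !msym_pure tensor_op_pure.
Qed.

Lemma msym_shift s c F : msym s (shift c F) = shift c (msym s F).
Proof.
apply: (@linear_pure_eq _ (msym s \o shift c) (shift c \o msym s)).
by move=> p /=; rewrite shift_pure !msym_pure shift_pure.
Qed.

Definition bounded (d : nat) F := forall mu, mu \in msupp F -> forall j, (mu j <= d)%N.

Lemma bounded_sum d (I : Type) (r : seq I) (P : pred I) (A : I -> {mpoly k[m]}) :
  (forall i, P i -> bounded d (A i)) -> bounded d (\sum_(i <- r | P i) A i).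
Proof.
move=> hA; apply: (big_ind (bounded d)) => [mu | F G hF hG mu | //].
  by rewrite msupp0.
by move=> /msuppD_le; rewrite mem_cat => /orP[/hF|/hG].
Qed.

Lemma boundedZ d c F : bounded d F -> bounded d (c *: F).
Proof. by move=> hF mu /msuppZ_le; apply: hF. Qed.

Lemma boundedB d F G : bounded d F -> bounded d G -> bounded d (F - G).
Proof. by move=> hF hG mu /msuppB_le; rewrite mem_cat => /orP[/hF|/hG]. Qed.

Lemma boundedX d mu : (forall j, mu j <= d)%N -> bounded d 'X_[mu].
Proof. by move=> h nu; rewrite msuppX inE => /eqP ->. Qed.

Lemma boundedM d e F G : bounded d F -> bounded e G -> bounded (d + e) (F * G).
Proof.
move=> hF hG mu /msuppM_le /allpairsP[[mu1 mu2] /= [/hF h1 /hG h2 ->]] j.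
by rewrite mnmDE leq_add.
Qed.

Lemma bounded_exp d n F : bounded d F -> bounded (d * n) (F ^+ n).
Proof.
move=> hF; elim: n => [|n IH].
  by rewrite expr0 -mpolyX0; apply: boundedX => j; rewrite mnmE.
by rewrite exprS mulnS; apply: boundedM.
Qed.

Lemma bounded_prod (I : Type) (r : seq I) (e : I -> nat) (A : I -> {mpoly k[m]}) :
  (forall i, bounded (e i) (A i)) ->
  bounded (\sum_(i <- r) e i)%N (\prod_(i <- r) A i).
Proof.
move=> hA; elim/big_rec2: _ => [|i d F _ hF]; last exact: boundedM.
by rewrite -mpolyX0; apply: boundedX => j; rewrite mnmE.
Qed.

Lemma bounded_pure_tensor d p :
  (forall j, size (p j) <= d.+1)%N -> bounded d (pure_tensor p).
Proof.
move=> szp; rewrite (eq_pure (fun j => poly_expand (szp j))) pure_sum.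
apply: bounded_sum => f _; apply: boundedZ.
have -> : pure_tensor (fun j => 'X^(f j)) = 'X_[[multinom (f j : nat) | j < m]].
  by rewrite mpolyX_pure; apply: eq_pure => j; rewrite mnmE.
by apply: boundedX => j; rewrite mnmE -ltnS.
Qed.

Lemma bounded_tensor_op (u : 'I_m -> {linear {poly k} -> {poly k}}) d e F :
    (forall j (p : {poly k}), (size p <= d.+1)%N -> (size (u j p) <= e.+1)%N) ->
  bounded d F -> bounded e (tensor_op u F).
Proof.
move=> hu hF; rewrite /tensor_op big_seq; apply: bounded_sum => mu Fmu.
apply: boundedZ; apply: bounded_pure_tensor => j; apply: hu.
by rewrite size_polyXn ltnS hF.
Qed.

Lemma bounded_msym d s F : bounded d F -> bounded d (msym s F).
Proof.
move=> hF mu; rewrite mcoeff_msupp mcoeff_sym -mcoeff_msupp => /hF h j.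
by have := h (s^-1 j)%g; rewrite mnmE permKV.
Qed.

End TensorOperators.

(** * Invariant symmetric polynomials are traces modulo the norm *)

Section RelativeTrace.

Variables (k : fieldType) (gT : finGroupType) (E : {group gT}) (a : gT -> k).
Hypothesis aM : {in E &, {morph a : g h / (g * h)%g >-> g + h}}.
Hypothesis a_inj : {in E &, injective a}.
Variable m : nat.
Hypothesis m_unit : m`!%:R != 0 :> k.

Implicit Types (F G H : {mpoly k[m]}) (p : 'I_m -> {poly k}).

Local Notation L := (vanishing E a).

Definition vanishing_quot (p : {poly k}) : {poly k} := p %/ L.

Fact vanishing_quot_is_linear : linear vanishing_quot.
Proof. by move=> c p r; rewrite /vanishing_quot divpD divpZl. Qed.

HB.instance Definition _ :=
  GRing.isLinear.Build k {poly k} {poly k} _ vanishing_quot vanishing_quot_is_linear.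

Definition high_part (p : {poly k}) : {poly k} := L * (p %/ L).

Fact high_part_is_linear : linear high_part.
Proof. by move=> c p r; rewrite /high_part divpD divpZl mulrDr scalerAr. Qed.

HB.instance Definition _ :=
  GRing.isLinear.Build k {poly k} {poly k} _ high_part high_part_is_linear.

(** If y_j and e_j are complementary parts of x_j, then x_1 ... x_m - y_1 ... y_m
    is the sum over i of the products with y_j before i, e_i at i and x_j after
    i. Here y_j is high_part, and e_i is the remainder, replaced by the operator
    spike of which it is the relative trace. *)
Definition higman_op (i j : 'I_m) : {linear {poly k} -> {poly k}} :=
  if (j < i)%N then (high_part : {linear _ -> _}) else
  if j == i then (spike E a : {linear _ -> _}) else (idfun : {linear _ -> _}).

Definition higman F : {mpoly k[m]} := \sum_i tensor_op (higman_op i) F.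

Fact higman_is_linear : linear higman.
Proof.
move=> c F G; rewrite /higman scaler_sumr -big_split /=.
by apply: eq_bigr => i _; rewrite linearP.
Qed.

HB.instance Definition _ :=
  GRing.isLinear.Build k {mpoly k[m]} {mpoly k[m]} _ higman higman_is_linear.

Lemma telescope_prod (R : comNzRingType) n (x y : 'I_n -> R) :
  \prod_j x j - \prod_j y j =
  \sum_(i < n) \prod_(j < n)
     (if (j < i)%N then y j else if j == i then x j - y j else x j).
Proof.
elim: n x y => [|n IH] x y; first by rewrite !big_ord0 subrr.
rewrite big_ord_recl [X in _ - X]big_ord_recl [RHS]big_ord_recl big_ord_recl /=.
rewrite (eq_bigr (fun j => x (lift ord0 j))) => [|j _]; last by [].
rewrite [X in _ = _ + X](eq_bigr (fun i : 'I_n => y ord0 * \prod_(j < n)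
  (if (j < i)%N then y (lift ord0 j) else if j == i
   then x (lift ord0 j) - y (lift ord0 j) else x (lift ord0 j)))) => [|i _].
  rewrite -mulr_sumr -IH; ring.
rewrite big_ord_recl /=; congr (_ * _); apply: eq_bigr => j _.
Qed.

Definition vanishing_prod : {mpoly k[m]} := pure_tensor (fun=> L).

Lemma pure_mul p r : pure_tensor p * pure_tensor r = pure_tensor (fun j => p j * r j).
Proof. by rewrite -big_split; apply: eq_bigr => j _; rewrite rmorphM. Qed.

Lemma pure_telescope p :
  pure_tensor p - vanishing_prod * tensor_op (fun=> vanishing_quot) (pure_tensor p) =
  \sum_(i < m) pure_tensor (fun j => if (j < i)%N then high_part (p j) else
                        if j == i then p j - high_part (p j) else p j).
Proof.
rewrite tensor_op_pure pure_mul telescope_prod; apply: eq_bigr => i _.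
by apply: eq_bigr => j _; case: ifP => // _; case: ifP => // _; rewrite rmorphB.
Qed.

Lemma pure_update_sum (I : finType) (A : {pred I}) (x : I -> {poly k}) i p :
  \sum_(g in A) pure_tensor (fun j => if j == i then x g else p j) =
  pure_tensor (fun j => if j == i then \sum_(g in A) x g else p j).
Proof.
rewrite /pure_tensor (bigD1 i) //= eqxx rmorph_sum mulr_suml; apply: eq_bigr => g _.
rewrite (bigD1 i) //= eqxx; congr (_ * _).
by apply: eq_bigr => j /negPf ->.
Qed.

(** Translations by elements of a(E) commute with high_part, so conjugating and
    summing only affects the factor where spike stands, and turns it into the
    remainder by sum_spike; the identity is then telescope_prod. *)
Lemma sum_shift_higman F :
  F - vanishing_prod * tensor_op (fun=> vanishing_quot) F =
  \sum_(g in E) shift (a g) (higman (shift (- a g) F)).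
Proof.
elim/pure_ind: F => [|c p F IH].
  by rewrite !linear0 mulr0 subr0 big1 // => g _; rewrite !linear0.
rewrite linearP mulrDr opprD addrACA -scalerAr -scalerBr IH.
under [RHS]eq_bigr => g _ do rewrite !linearP.
rewrite big_split -scaler_sumr /=; congr (_ *: _ + _).
rewrite pure_telescope; under [RHS]eq_bigr => g _ do
  rewrite shift_pure /higman linear_sum.
rewrite exchange_big; apply: eq_bigr => i _ /=.
pose r (j : 'I_m) := if (j < i)%N then high_part (p j) else p j.
pose x g := translate (a g) (spike E a (translate (- a g) (p i))).
transitivity (\sum_(g in E) pure_tensor (fun j => if j == i then x g else r j)).
  rewrite pure_update_sum; apply: eq_pure => j; rewrite /r.
  case: eqP => [-> | _]; last by [].
  by rewrite ltnn /x -sum_spike.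
apply: eq_bigr => g Eg; rewrite tensor_op_pure shift_pure; apply: eq_pure => j.
rewrite /r /higman_op; case: eqP => [-> | _]; first by rewrite ltnn.
case: ifP => _; last by rewrite translateD addrN translate0.
rewrite /= /high_part rmorphM /= translate_vanishing // translate_divp //.
by rewrite translateD addrN translate0.
Qed.

Lemma shift_vanishing_quot F g : g \in E ->
  shift (a g) (tensor_op (fun=> vanishing_quot) F) =
  tensor_op (fun=> vanishing_quot) (shift (a g) F).
Proof.
move=> Eg; elim/pure_ind: F => [|c p F IH]; first by rewrite !linear0.
rewrite !linearP /= IH tensor_op_pure !shift_pure tensor_op_pure; congr (_ *: _ + _).
by apply: eq_pure => j; apply: translate_divp.
Qed.

Lemma bounded_higman d F : (#|E| <= d.+1)%N ->
  bounded d F -> bounded d (higman F).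
Proof.
move=> qd hF; apply: bounded_sum => i _; apply: bounded_tensor_op hF => j p szp.
rewrite /higman_op; case: ifP => _.
  rewrite /= /high_part mulrC.
  have [-> | r0] := eqVneq (p %/ L) 0; first by rewrite mul0r size_poly0.
  rewrite size_Mmonic ?vanishing_monic //; move: r0.
  rewrite -size_poly_gt0 size_divp ?vanishing_neq0 // size_vanishing.
  by move: szp; move: (size p) #|E| => s e; lia.
case: ifP => // _; apply: leq_trans (size_scale_leq _ _) _.
exact: leq_trans (size_delta E a) qd.
Qed.

(** For an invariant F the inner translation in sum_shift_higman disappears,
    and F - vanishing_prod * G is a trace. The operator higman treats the
    variables in order, so its value is averaged over all permutations. *)
Lemma symmetric_trace_decomposition d F :
    (#|E| <= d)%N -> bounded d F -> F \is symmetric ->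
    {in E, forall g, shift (a g) F = F} ->
  exists G H, [/\ bounded (d - #|E|) G, G \is symmetric,
      {in E, forall g, shift (a g) G = G}, bounded d H & H \is symmetric /\
    F = vanishing_prod * G + \sum_(g in E) shift (a g) H].
Proof.
move=> qd hF symF fixF; pose G := tensor_op (fun=> vanishing_quot) F.
have trF : F - vanishing_prod * G = \sum_(g in E) shift (a g) (higman F).
  rewrite sum_shift_higman; apply: eq_bigr => g Eg.
  by rewrite -(additive_charV aM) // fixF ?groupV.
have symL : vanishing_prod \is symmetric.
  by apply/issymP => s; rewrite msym_pure.
have symG : G \is symmetric.
  by apply/issymP => s; rewrite msym_tensor_op (issymP _ symF).
pose H := m`!%:R^-1 *: \sum_(s : 'S_m) msym s (higman F).
exists G, H; split=> //.
- apply: bounded_tensor_op hF => j p szp.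
  rewrite /vanishing_quot size_divp ?vanishing_neq0 // size_vanishing.
  by move: szp qd; move: (size p) #|E| => s e; lia.
- by move=> g Eg; rewrite shift_vanishing_quot // fixF.
- apply: boundedZ; apply: bounded_sum => s _; apply: bounded_msym.
  by apply: bounded_higman hF; apply: leqW.
split.
  apply: rpredZ; apply/issymP => t; rewrite linear_sum /=.
  rewrite [RHS](reindex_inj (mulIg t)) /=.
  by apply: eq_bigr => s _; rewrite msymMm.
rewrite -[LHS](subrK (vanishing_prod * G)) addrC; congr (_ + _).
transitivity (m`!%:R^-1 *: \sum_(s : 'S_m) msym s (F - vanishing_prod * G)).
  rewrite (eq_bigr (fun=> F - vanishing_prod * G)) => [|s _].
    rewrite sumr_const card_Sn -scaler_nat scalerA mulVf ?scale1r //.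
  by apply/issymP; rewrite rpredB // rpredM.
under [RHS]eq_bigr => g _ do rewrite linearZ linear_sum.
rewrite -scaler_sumr; congr (_ *: _); rewrite [RHS]exchange_big; apply: eq_bigr => s _ /=.
by rewrite trF linear_sum; apply: eq_bigr => g _; apply: msym_shift.
Qed.

End RelativeTrace.

(** * Polynomials in the coefficients of a form as symmetric polynomials in its roots *)

Section RootCoordinates.

Variables (k : fieldType) (m : nat).

Local Notation S := {mpoly k[m.+1]}.
Local Notation R := {mpoly k[m]}.
Local Notation sigma := [tuple mesym m k i.+1 | i < m].

Lemma bounded_mesym i : bounded 1 (mesym m k i).
Proof.
by move=> mu; rewrite mem_msupp_mesym => /andP[_ /forallP].
Qed.

Lemma sumn_telescope (c : nat -> nat) n : (forall i, i < n -> c i.+1 <= c i)%N ->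
  (\sum_(i < n) (c i - c i.+1) = c 0%N - c n)%N.
Proof.
elim: n => [|n IH] hc; first by rewrite big_ord0 subnn.
rewrite big_ord_recr /= IH => [|i /ltnW]; last exact: hc.
have cn : (c n <= c 0)%N.
  elim: n hc {IH} => // n IH hc; apply: leq_trans (hc n _) (IH _) => //.
  by move=> i /ltnW; apply: hc.
have := hc n (ltnSn n); lia.
Qed.

(** In one step of the usual algorithm, the leading exponents c_0 >= c_1 >= ...
    of F are cancelled by a product of the elementary symmetric polynomials
    having c_i - c_(i+1) factors of index i+1. It has c_0 <= d factors, each of
    degree one in every variable, so the bound d is never exceeded. *)
Lemma sym_fundamental_bounded d (F : R) : bounded d F -> F \is symmetric ->
  exists2 t : R, t \mPo sigma = F & (msize t <= d.+1)%N.
Proof.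
elim/mleadrect: F => F IH hF symF.
have [-> | F0] := eqVneq F 0.
  by exists 0; rewrite ?comp_mpoly0 ?msize0.
have /and3P[lt_lead sym2 /eqP FE] := symf1P symF.
pose c i := nth 0%N (mlead F) i.
pose mu : 'X_{1..m} := [multinom (c i - c i.+1)%N | i < m].
have s1E : (symf1 F).1 = mleadc F *: 'X_[mu].
  by rewrite /symf1 (negPf F0).
have c_le i : (c i <= d)%N.
  rewrite /c; case: (ltnP i m) => im; last by rewrite nth_default ?size_tuple.
  by rewrite -(mnm_nth _ _ (Ordinal im)) hF ?mlead_supp.
have mdeg_mu : (mdeg mu <= d)%N.
  rewrite mdegE (eq_bigr (fun i : 'I_m => c i - c i.+1)%N) => [|i _]; last first.
    by rewrite mnmE.
  rewrite sumn_telescope ?(leq_trans (leq_subr _ _)) // => i im.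
  rewrite /c; case: (ltnP i.+1 m) => im'; last first.
    by rewrite [X in (X <= _)%N]nth_default ?size_tuple.
  rewrite -(mnm_nth _ _ (Ordinal im)) -(mnm_nth _ _ (Ordinal im')).
  exact: mlead_msym_sorted.
have h1 : bounded d ((symf1 F).1 \mPo sigma).
  rewrite s1E comp_mpolyZ comp_mpolyX; apply: boundedZ => nu hnu j.
  apply: leq_trans mdeg_mu; move: nu hnu j; rewrite mdegE.
  apply: bounded_prod => i; rewrite -[X in bounded X]mul1n; apply: bounded_exp.
  by rewrite tnth_mktuple; apply: bounded_mesym.
have h2 : bounded d (symf1 F).2.
  have -> : (symf1 F).2 = F - ((symf1 F).1 \mPo sigma).
    by apply/eqP; rewrite eq_sym subr_eq [X in _ == X]addrC -FE.
  exact: boundedB.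
have [t tE szt] : exists2 t : R, t \mPo sigma = (symf1 F).2 & (msize t <= d.+1)%N.
  case/orP: lt_lead => [/eqP -> | lt]; last exact: IH.
  by exists 0; rewrite ?comp_mpoly0 ?msize0.
exists ((symf1 F).1 + t); first by rewrite comp_mpolyD tE -FE.
apply: leq_trans (msizeD_le _ _) _; rewrite geq_max szt andbT s1E.
by apply: leq_trans (msizeZ_le _ _) _; rewrite msizeX ltnS.
Qed.

(** The form prod_l (X_1 + y_l X_0) has the coefficient e_(m-i)(y) at
    X_0^(m-i) X_1^i; so this is the restriction of polynomials on V to the
    products of such linear forms. *)
Definition root_eval : S -> R :=
  comp_mpoly [tuple mesym m k (m - i) | i < m.+1].

HB.instance Definition _ := GRing.LRMorphism.copy root_eval
  (comp_mpoly [tuple mesym m k (m - i) | i < m.+1]).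

Lemma root_evalX i : root_eval 'X_i = mesym m k (m - i).
Proof. by rewrite /root_eval comp_mpolyXU -tnth_nth tnth_mktuple. Qed.

Lemma root_eval_symmetric f : root_eval f \is symmetric.
Proof.
by apply: mcomp_sym => i; rewrite -tnth_nth tnth_mktuple mesym_sym.
Qed.

Lemma root_eval_bounded d f : f \is d.-homog -> bounded d (root_eval f).
Proof.
move=> hf; rewrite /root_eval comp_mpolyE big_seq; apply: bounded_sum => mu fmu.
apply: boundedZ; rewrite -(dhomog_mf hf fmu : mdeg mu = d) mdegE.
apply: bounded_prod => i; rewrite -[X in bounded X]mul1n; apply: bounded_exp.
by rewrite tnth_mktuple; apply: bounded_mesym.
Qed.

(** root_eval maps the variable of index m to 1 and that of index m-1-i to the
    elementary symmetric polynomial of index i+1; so the exponent of the former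
    is dropped, and the others are reversed. *)
Definition dehom_mnm (mu : 'X_{1..m.+1}) : 'X_{1..m} :=
  [multinom mu (widen_ord (leqnSn m) (rev_ord i)) | i < m].

Definition hom_mnm d (mu : 'X_{1..m}) : 'X_{1..m.+1} :=
  [multinom (if unlift ord_max i is Some j then mu (rev_ord j) else d - mdeg mu)%N
     | i < m.+1].

Lemma mdeg_split (mu : 'X_{1..m.+1}) : mdeg mu = (mdeg (dehom_mnm mu) + mu ord_max)%N.
Proof.
rewrite !mdegE big_ord_recr /=; congr (_ + _)%N.
by rewrite (reindex_inj rev_ord_inj); apply: eq_bigr => i _; rewrite mnmE.
Qed.

Lemma dehom_mnm_inj (mu nu : 'X_{1..m.+1}) :
  mdeg mu = mdeg nu -> dehom_mnm mu = dehom_mnm nu -> mu = nu.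
Proof.
move=> emn e; apply/mnmP => i; move: emn; rewrite !mdeg_split e => /addnI emax.
case: (unliftP ord_max i) => [j -> | -> //].
have -> : lift ord_max j = widen_ord (leqnSn m) (rev_ord (rev_ord j)).
  by apply: val_inj; rewrite rev_ordK /= /bump leqNgt ltn_ord.
by have /mnmP/(_ (rev_ord j)) := e; rewrite !mnmE.
Qed.

Lemma root_evalX_mnm mu : root_eval 'X_[mu] = 'X_[dehom_mnm mu] \mPo sigma.
Proof.
rewrite /root_eval !comp_mpolyX big_ord_recr /= tnth_mktuple subnn mesym0E.
rewrite expr1n mulr1 (reindex_inj rev_ord_inj); apply: eq_bigr => i _.
by rewrite !tnth_mktuple mnmE /= subKn.
Qed.

Lemma dehom_hom_mnm d mu : dehom_mnm (hom_mnm d mu) = mu.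
Proof.
apply/mnmP => i; rewrite !mnmE.
have -> : widen_ord (leqnSn m) (rev_ord i) = lift ord_max (rev_ord i).
  by apply: val_inj; rewrite /= /bump leqNgt; have := ltn_ord (rev_ord i) => /= ->.
by rewrite liftK rev_ordK.
Qed.

Lemma mdeg_hom_mnm d mu : (mdeg mu <= d)%N -> mdeg (hom_mnm d mu) = d.
Proof.
by move=> hmu; rewrite mdeg_split dehom_hom_mnm mnmE unlift_none subnKC.
Qed.

(** A polynomial of degree at most d in the elementary symmetric polynomials is
    made homogeneous of degree d by powers of the last variable. *)
Lemma root_eval_surj d F : bounded d F -> F \is symmetric ->
  exists2 f : S, f \is d.-homog & root_eval f = F.
Proof.
move=> hF symF; have [t <- szt] := sym_fundamental_bounded hF symF.
exists (\sum_(mu <- msupp t) t@_mu *: 'X_[hom_mnm d mu]).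
  rewrite big_seq; apply: rpred_sum => mu tmu; apply: rpredZ.
  rewrite dhomogX /= mdeg_hom_mnm // -ltnS.
  exact: leq_trans (msize_mdeg_lt tmu) szt.
rewrite linear_sum comp_mpolyEX; apply: eq_bigr => mu _.
by rewrite linearZ /= root_evalX_mnm dehom_hom_mnm.
Qed.

(** The elementary symmetric polynomials are algebraically independent, and in
    a given degree the exponent of the last variable, which root_eval maps to 1,
    is determined by the others. *)
Lemma root_eval_inj d f g : f \is d.-homog -> g \is d.-homog ->
  root_eval f = root_eval g -> f = g.
Proof.
move=> hf hg /eqP; rewrite -subr_eq0 -rmorphB => /eqP.
set h := f - g => h0; apply/eqP; rewrite -subr_eq0 -/h; apply/eqP.
have hh : h \is d.-homog by rewrite rpredB.
have : \sum_(mu <- msupp h) h@_mu *: 'X_[dehom_mnm mu] = 0.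
  apply: msym_fundamental_un0; apply: etrans h0.
  rewrite [in RHS](mpolyE h) linear_sum raddf_sum.
  by apply: eq_bigr => mu _ /=; rewrite !linearZ /= root_evalX_mnm.
move=> e; apply/mpolyP => mu; rewrite mcoeff0.
have [hmu | /memN_msupp_eq0 //] := boolP (mu \in msupp h).
have /(congr1 (mcoeff (dehom_mnm mu))) := e.
rewrite linear_sum (bigD1_seq mu) //= mcoeffZ mcoeffX eqxx mulr1 mcoeff0.
rewrite big_seq_cond big1 ?addr0 // => nu /andP[hnu ne].
rewrite mcoeffZ mcoeffX; case: eqP => [/dehom_mnm_inj e2 | _]; last by rewrite mulr0.
by rewrite e2 ?eqxx // ?(dhomog_mf hh hnu) ?(dhomog_mf hh hmu) in ne.
Qed.

End RootCoordinates.

(** * The action of shears on k[V] *)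

Lemma mpoly_morph_eq (k : fieldType) n (A : comAlgType k)
    (f g : {lrmorphism {mpoly k[n]} -> A}) :
  (forall i, f 'X_i = g 'X_i) -> f =1 g.
Proof.
move=> efg p; rewrite [p]mpolyE !linear_sum; apply: eq_bigr => mu _.
rewrite !linearZ /= mpolyXE_id !rmorph_prod; congr (_ *: _).
by apply: eq_bigr => i _; rewrite !rmorphXn /= efg.
Qed.

Section Equivariance.

Variables (k : fieldType) (m : nat).

Local Notation S := {mpoly k[m.+1]}.
Local Notation R := {mpoly k[m]}.

(** How the coordinate functions on S^m(W) change when X_1 becomes
    X_1 - c X_0. *)
Definition binomial_mx (c : k) : 'M[k]_m.+1 :=
  \matrix_(i, j) ('C(j, i)%:R * (- c) ^+ (j - i)).

Definition shear_act (c : k) : S -> S := lin_subst (binomial_mx c).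

HB.instance Definition _ c := GRing.LRMorphism.copy (shear_act c)
  (comp_mpoly [tuple \sum_(j < m.+1) binomial_mx c i j *: 'X_j | i < m.+1]).

Lemma shear_actX c i :
  shear_act c 'X_i = \sum_(j < m.+1) ('C(j, i)%:R * (- c) ^+ (j - i)) *: 'X_j.
Proof.
rewrite /shear_act /lin_subst comp_mpolyXU -tnth_nth tnth_mktuple.
by apply: eq_bigr => j _; rewrite mxE.
Qed.

Lemma shear_act_homog c d f : f \is d.-homog -> shear_act c f \is d.-homog.
Proof. exact: lin_subst_homog. Qed.

Lemma coef_XaddC_exp (T : comNzRingType) (c : T) n i :
  (('X + c%:P) ^+ n)`_i = 'C(n, i)%:R * c ^+ (n - i).
Proof.
rewrite addrC exprDn coef_sum.
have [le_in | lt_ni] := leqP i n.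
  rewrite (bigD1 (Ordinal (le_in : i < n.+1)%N)) //= big1 => [|l ne].
    rewrite addr0 coefMn -polyC_exp coefCM coefXn eqxx mulr1.
    by rewrite mulr_natl.
  rewrite coefMn -polyC_exp coefCM coefXn; case: eqP => [e | _].
    by case/eqP: ne; apply: val_inj.
  by rewrite mulr0 mul0rn.
rewrite bin_small // mul0r big1 // => l _.
rewrite coefMn -polyC_exp coefCM coefXn; case: eqP => [e | _].
  by have := ltn_ord l; rewrite -e ltnS leqNgt lt_ni.
by rewrite mulr0 mul0rn.
Qed.

Definition root_poly : {poly R} := \prod_(l < m) ('X + ('X_l)%:P).

Lemma root_polyE : root_poly = \sum_(i < m.+1) mesym m k (m - i) *: 'X^i.
Proof.
rewrite /root_poly (eq_bigr (fun l => ('X_l)%:P + 'X)) => [|l _]; last exact: addrC.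
rewrite bigA_distr (reindex_inj rev_ord_inj) /=.
rewrite (partition_big (fun J : {set 'I_m} => inord #|J| : 'I_m.+1) xpredT) //=.
apply: eq_bigr => i _; rewrite subSS subKn -1?ltnS // /mesym scaler_suml.
have cardJ (J : {set 'I_m}) : (#|J| < m.+1)%N.
  by rewrite ltnS -[X in (_ <= X)%N](card_ord m) max_card.
apply: eq_big => [J | J /eqP eJ].
  by rewrite -val_eqE /= inordK.
have {}eJ : #|J| = i by rewrite -eJ inordK.
rewrite (bigID (mem J)) /= -mul_polyC rmorph_prod; congr (_ * _).
  by apply: eq_bigr => l ->.
rewrite (eq_bigr (fun=> 'X)) => [|l /negPf -> //].
rewrite prodr_const; congr (_ ^+ _); rewrite -eJ.
by apply: (@addnI #|J|); rewrite subnKC -1?ltnS // -[RHS]card_ord -(cardC (mem J)).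
Qed.

(** Translating the roots amounts to substituting T - c for T in
    prod_l (T + y_l); compare the coefficients of T^i. *)
Lemma shift_mesym c (i : 'I_m.+1) : shift c (mesym m k (m - i)) =
  \sum_(j < m.+1) ('C(j, i)%:R * (- c) ^+ (j - i)) *: mesym m k (m - j).
Proof.
have rootP (j : 'I_m.+1) : mesym m k (m - j) = root_poly`_j.
  rewrite root_polyE -(poly_def m.+1 (fun i => mesym m k (m - i))) coef_poly.
  by rewrite ltn_ord.
have tr : map_poly (shift c) root_poly = root_poly \Po ('X + (- c%:MP)%:P).
  rewrite /root_poly !rmorph_prod; apply: eq_bigr => l _ /=.
  rewrite !rmorphD /= map_polyX map_polyC /= shiftXU comp_polyX comp_polyC.
  by rewrite polyCD; ring.
rewrite rootP -coef_map /= tr root_polyE rmorph_sum coef_sum /=.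
apply: eq_bigr => j _; rewrite comp_polyZ comp_Xn_poly coefZ coef_XaddC_exp.
rewrite -mpolyCN -mpolyC_nat -rmorphXn /= -mpolyCM mulrC.
by rewrite mul_mpolyC.
Qed.

(** A shear acts on products of linear forms by translating all the roots at
    once. *)
Lemma root_eval_act c f : root_eval (shear_act c f) = shift c (root_eval f).
Proof.
apply: (@mpoly_morph_eq _ _ _ (@root_eval k m \o shear_act c)
  (shift c \o @root_eval k m)) => i /=.
rewrite shear_actX linear_sum root_evalX shift_mesym; apply: eq_bigr => j _.
by rewrite linearZ /= root_evalX.
Qed.

Lemma shear_actX_homog c i : shear_act c 'X_i \is 1.-homog.
Proof. by apply: shear_act_homog; rewrite dhomogX /= mdeg1. Qed.

(** On variables the two sides have the same image under root_eval, where the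
    action is by translations; this hides a Vandermonde identity. *)
Lemma shear_actD c d f : shear_act c (shear_act d f) = shear_act (c + d) f.
Proof.
apply: (@mpoly_morph_eq _ _ _ (shear_act c \o shear_act d) (shear_act (c + d))) => i /=.
apply: (root_eval_inj (shear_act_homog c (shear_actX_homog d i))
  (shear_actX_homog (c + d) i)).
by rewrite !root_eval_act shiftD.
Qed.

Lemma shear_act0 f : shear_act 0 f = f.
Proof.
apply: (@mpoly_morph_eq _ _ _ (shear_act 0) idfun) => i /=.
apply: (root_eval_inj (shear_actX_homog 0 i)); first by rewrite dhomogX /= mdeg1.
by rewrite root_eval_act shift0.
Qed.

End Equivariance.

Section Invariants.

Variables (k : fieldType) (gT : finGroupType) (E : {group gT}) (a : gT -> k).
Hypothesis aM : {in E &, {morph a : g h / (g * h)%g >-> g + h}}.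
Hypothesis a_inj : {in E &, injective a}.
Variable m : nat.
Hypothesis m_unit : m`!%:R != 0 :> k.
Hypothesis card0 : #|E|%:R = 0 :> k.

Local Notation S := {mpoly k[m.+1]}.
Implicit Types (f h w : S).

Definition act_fixed f := {in E, forall g, shear_act (a g) f = f}.

Definition trace f : S := \sum_(g in E) shear_act (a g) f.

Fact trace_is_linear : linear trace.
Proof.
move=> c f h; rewrite /trace scaler_sumr -big_split /=.
by apply: eq_bigr => g _; rewrite linearP.
Qed.

HB.instance Definition _ :=
  GRing.isLinear.Build k {mpoly k[m.+1]} {mpoly k[m.+1]} _ trace trace_is_linear.

Lemma trace_fixed f : act_fixed (trace f).
Proof.
move=> g Eg; rewrite /trace rmorph_sum /=.
under eq_bigr => h _ do rewrite shear_actD.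
by rewrite -(sum_translate_group aM (fun c => shear_act c f)).
Qed.

Lemma trace_homog d f : f \is d.-homog -> trace f \is d.-homog.
Proof. by move=> hf; apply: rpred_sum => g _; apply: shear_act_homog. Qed.

Lemma trace_mull f h : act_fixed f -> trace (f * h) = f * trace h.
Proof.
move=> fixf; rewrite mulr_sumr; apply: eq_bigr => g Eg.
by rewrite rmorphM /= fixf.
Qed.

Definition norm : S := \prod_(g in E) shear_act (a g) 'X_ord0.

Lemma norm_fixed : act_fixed norm.
Proof.
move=> h Eh; rewrite /norm rmorph_prod /= [RHS](reindex_inj (mulgI h)) /=.
apply: eq_big => [g | g Eg]; first by rewrite groupMl.
by rewrite shear_actD aM.
Qed.

Lemma norm_homog : norm \is #|E|.-homog.
Proof.
rewrite /norm -sum1_card; elim/big_rec2: _ => [|g d f _ hf]; first exact: dhomog1.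
by apply: dhomogM; rewrite ?shear_actX_homog.
Qed.

Lemma root_eval_norm : root_eval norm = vanishing_prod E a m.
Proof.
rewrite /norm rmorph_prod /= /vanishing_prod /pure_tensor /vanishing.
under [RHS]eq_bigr => l _ do rewrite rmorph_prod.
rewrite exchange_big; apply: eq_bigr => g _ /=.
rewrite root_eval_act root_evalX subn0 mesymnnE rmorph_prod.
by apply: eq_bigr => l _; rewrite /= shiftXU rmorphB /= in_varX in_varC.
Qed.

Lemma fixed_norm_trace d f : (#|E| <= d)%N -> f \is d.-homog -> act_fixed f ->
  exists g h, [/\ g \is (d - #|E|).-homog, act_fixed g, h \is d.-homog &
    f = norm * g + trace h].
Proof.
move=> qd hf fixf.
have fixF : {in E, forall g, shift (a g) (root_eval f) = root_eval f}.
  by move=> g Eg; rewrite -root_eval_act fixf.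
have [G [H [bG sG fixG bH [sH FE]]]] := symmetric_trace_decomposition aM a_inj
  m_unit qd (root_eval_bounded hf) (root_eval_symmetric f) fixF.
have [g hg gE] := root_eval_surj bG sG; have [h hh hE] := root_eval_surj bH sH.
exists g, h; split=> // [b Eb|].
  by apply: root_eval_inj (shear_act_homog _ hg) hg _; rewrite root_eval_act gE fixG.
apply: root_eval_inj hf _ _.
  by rewrite rpredD ?trace_homog // -{1}(subnKC qd) dhomogM ?norm_homog.
rewrite rmorphD rmorphM /= root_eval_norm gE FE /trace rmorph_sum.
by congr (_ + _); apply: eq_bigr => b _; rewrite /= root_eval_act hE.
Qed.

End Invariants.

(** * The Hilbert ideal and generation in low degree *)

Lemma msize_homog (k : fieldType) n d (f : {mpoly k[n]}) :
  f \is d.-homog -> (msize f <= d.+1)%N.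
Proof.
move=> hf; rewrite msizeE big_seq; apply/bigmax_leqP_seq => mu /= fmu _.
by rewrite (dhomog_mf hf fmu : mdeg mu = d).
Qed.

Section HilbertIdeal.

Variables (k : fieldType) (gT : finGroupType) (E : {group gT}) (a : gT -> k).
Hypothesis aM : {in E &, {morph a : g h / (g * h)%g >-> g + h}}.
Hypothesis a_inj : {in E &, injective a}.
Variable m : nat.
Hypothesis m_unit : m`!%:R != 0 :> k.
Hypothesis card0 : #|E|%:R = 0 :> k.

Local Notation S := {mpoly k[m.+1]}.
Local Notation q := #|E|.
Local Notation fixed := (act_fixed E a).
Local Notation tr := (trace E a).
Implicit Types (f h w : S).

(** The degree bound q, rather than all positive degrees, keeps the generators
    among the invariants that are known to be generated in low degree. *)
Inductive hilbert_ideal : S -> Prop :=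
| HilbertGen c f e : fixed c -> c \is e.-homog -> (0 < e <= q)%N ->
    hilbert_ideal (c * f)
| HilbertAdd f h : hilbert_ideal f -> hilbert_ideal h -> hilbert_ideal (f + h).

Lemma hilbert_ideal_mull f h : hilbert_ideal h -> hilbert_ideal (f * h).
Proof.
elim=> [c f' e fc hc he | h1 h2 _ IH1 _ IH2]; last by rewrite mulrDr; apply: HilbertAdd.
by rewrite mulrCA; apply: HilbertGen he.
Qed.

Lemma hilbert_ideal_mulr f h : hilbert_ideal h -> hilbert_ideal (h * f).
Proof. by rewrite mulrC; apply: hilbert_ideal_mull. Qed.

Lemma hilbert_ideal_norm : hilbert_ideal (norm E a m).
Proof.
rewrite -[norm _ _ _]mulr1; apply: HilbertGen (norm_homog E a m) _.
  exact: norm_fixed.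
by rewrite cardG_gt0 leqnn.
Qed.

Lemma hilbert_ideal0 : hilbert_ideal 0.
Proof. by rewrite -(mul0r (norm E a m)); apply/hilbert_ideal_mull/hilbert_ideal_norm. Qed.

Lemma hilbert_ideal_sum (I : Type) (r : seq I) (P : pred I) (F : I -> S) :
  (forall i, P i -> hilbert_ideal (F i)) -> hilbert_ideal (\sum_(i <- r | P i) F i).
Proof.
by move=> hF; apply: big_ind => //; [apply: hilbert_ideal0 | apply: HilbertAdd].
Qed.

Lemma hilbert_idealZ c h : hilbert_ideal h -> hilbert_ideal (c *: h).
Proof. by rewrite -mul_mpolyC; apply: hilbert_ideal_mull. Qed.

Lemma hilbert_idealB f h : hilbert_ideal f -> hilbert_ideal h -> hilbert_ideal (f - h).
Proof.
by move=> hf hh; rewrite -scaleN1r; apply/HilbertAdd/hilbert_idealZ.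
Qed.

Lemma trace1 : tr (1 : S) = 0.
Proof.
rewrite /trace (eq_bigr (fun=> 1)) => [|g _]; last exact: rmorph1.
by rewrite sumr_const -mpolyC_nat card0.
Qed.

Lemma homog0_const w : w \is 0.-homog -> w = (w@_0)%:MP.
Proof.
by move=> hw; apply/msize1_polyC/msize_homog.
Qed.

(** In degree 0 the trace is multiplication by q, which is 0 in k. *)
Lemma trace_in_hilbert_ideal w r : w \is r.-homog -> (r <= q)%N -> hilbert_ideal (tr w).
Proof.
move=> hw rq; case: r => [|r] in hw rq *.
  rewrite (homog0_const hw) -[_%:MP]mulr1 mul_mpolyC linearZ /= trace1 scaler0.
  exact: hilbert_ideal0.
by rewrite -[tr w]mulr1; apply: HilbertGen (trace_fixed aM w) (trace_homog E a hw) _.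
Qed.

(** Expanding the product gives polynomials times traces of w times some of the
    forms z.2, and such a trace has degree at most q. *)
Lemma sum_prod_in_hilbert_ideal (s : seq (S * S)) w r :
    w \is r.-homog -> (r + size s <= q)%N -> {in s, forall z, z.2 \is 1.-homog} ->
  hilbert_ideal (\sum_(b in E) shear_act (a b) w *
                   \prod_(z <- s) (z.1 - shear_act (a b) z.2)).
Proof.
elim: s w r => [|[c u] s IH] w r hw rsq hs.
  under eq_bigr => b _ do rewrite big_nil mulr1.
  by apply: trace_in_hilbert_ideal hw _; rewrite addn0 in rsq.
have hu : u \is 1.-homog by apply: (hs (c, u)); rewrite inE eqxx.
have hs' : {in s, forall z, z.2 \is 1.-homog}.
  by move=> z sz; apply: hs; rewrite inE sz orbT.
have -> : \sum_(b in E) shear_act (a b) w *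
      \prod_(z <- (c, u) :: s) (z.1 - shear_act (a b) z.2) =
  c * (\sum_(b in E) shear_act (a b) w * \prod_(z <- s) (z.1 - shear_act (a b) z.2)) -
  \sum_(b in E) shear_act (a b) (w * u) * \prod_(z <- s) (z.1 - shear_act (a b) z.2).
  rewrite mulr_sumr -sumrB; apply: eq_bigr => b _.
  by rewrite big_cons rmorphM /=; ring.
apply: hilbert_idealB.
  by apply/hilbert_ideal_mull/(IH _ r) => //=; move: rsq => /=; lia.
by apply: (IH _ (r + 1)%N) => //; [apply: dhomogM | move: rsq => /=; lia].
Qed.

Lemma card_nontriv : size (enum (E^#)%g) = q.-1.
Proof. by rewrite -cardE (cardsD1 1%g E) group1. Qed.

(** The product is the term b = 1 of the sum over b in E of the products of the
    g(u_g) - b(u_g); all other terms contain the zero factor with g = b. *)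
Lemma prod_diff_in_hilbert_ideal (u : gT -> S) :
    (forall g, u g \is 1.-homog) ->
  hilbert_ideal (\prod_(g <- enum (E^#)%g) (shear_act (a g) (u g) - u g)).
Proof.
move=> hu; pose s := [seq (shear_act (a g) (u g), u g) | g <- enum (E^#)%g].
have -> : \prod_(g <- enum (E^#)%g) (shear_act (a g) (u g) - u g) =
  \sum_(b in E) shear_act (a b) 1 * \prod_(z <- s) (z.1 - shear_act (a b) z.2).
  rewrite (bigD1 1%g) //= [X in _ + X]big1 => [|b /andP[Eb b1]].
    rewrite addr0 rmorph1 mul1r big_map (additive_char1 aM).
    by apply: eq_bigr => g _ /=; rewrite shear_act0.
  rewrite big_map big_enum (bigD1 b) ?in_setD1 ?b1 //=.
  by rewrite subrr mul0r mulr0.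
apply: (sum_prod_in_hilbert_ideal (dhomog1 _ _)).
  by rewrite size_map card_nontriv leq_pred.
by move=> z /mapP[g _ ->]; apply: hu.
Qed.

(** On linear forms, g - 1 maps the variable of index i to (i+1)(-c) times the
    next one plus a combination of later ones; i+1 divides m!, hence is
    invertible, and one can solve starting from the last variable. *)
Lemma var_in_range c (j : 'I_m) : c != 0 ->
  exists2 u : S, u \is 1.-homog & shear_act c u - u = 'X_(lift ord0 j).
Proof.
move=> c0; pose inr (x : S) := exists2 u : S, u \is 1.-homog & shear_act c u - u = x.
have inrD x y : inr x -> inr y -> inr (x + y).
  move=> [u hu <-] [v hv <-]; exists (u + v); first by rewrite rpredD.
  by rewrite rmorphD /=; ring.
have inrZ b x : inr x -> inr (b *: x).
  move=> [u hu <-]; exists (b *: u); first by rewrite rpredZ.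
  by rewrite linearZ /= scalerBr.
have inr0 : inr 0 by exists 0; rewrite ?rpred0 // rmorph0 subr0.
suff all n (i : 'I_m) : (m - i <= n)%N -> inr 'X_(lift ord0 i) by apply: (all m); lia.
elim: n i => [|n IH] i hn; first by have := ltn_ord i; lia.
pose i' : 'I_m.+1 := widen_ord (leqnSn m) i.
pose F (l : 'I_m.+1) : S := ('C(l, i)%:R * (- c) ^+ (l - i)) *: 'X_l.
have iE : inr (shear_act c 'X_i' - 'X_i') by exists 'X_i'; rewrite // dhomogX /= mdeg1.
(* The coefficient of the variable of index i+1 in (g - 1) applied to that of
   index i. *)
have b0 : i.+1%:R * - c != 0.
  rewrite mulf_neq0 ?oppr_eq0 //; apply: contraNneq m_unit => i0.
  have /dvdnP[b ->] : (i.+1 %| m`!)%N by rewrite dvdn_fact //=.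
  by rewrite natrM i0 mulr0.
have e : shear_act c 'X_i' - 'X_i' =
  F (lift ord0 i) + \sum_(l < m.+1 | (i.+1 < l)%N) F l.
  rewrite shear_actX (bigID (fun l : 'I_m.+1 => i.+1 < l)%N) /=.
  rewrite [X in _ + X - _](bigD1 i') /= ?ltnNge ?leqnSn // subnn expr0 mulr1 binn scale1r.
  rewrite [X in _ + (_ + X) - _](bigD1 (lift ord0 i)) /=; last first.
    by rewrite ltnn -val_eqE /= /bump; lia.
  rewrite [X in _ + (_ + (_ + X)) - _]big1 => [|l]; first by rewrite /F /=; ring.
  rewrite -!val_eqE /= /bump /= => h.
  by rewrite bin_small ?mul0r ?scale0r //; lia.
have hs : inr (\sum_(l < m.+1 | (i.+1 < l)%N) F l).
  apply: (big_ind inr) => // l il; apply: (inrZ _ _).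
  have [l' lE] : exists l', l = lift ord0 l'.
    by case: (unliftP ord0 l) il => [l' -> | -> //]; exists l'.
  by rewrite lE; apply: IH; move: il hn; rewrite lE /= /bump; lia.
have := inrD _ _ iE (inrZ (-1) _ hs); rewrite scaleN1r e addrK.
move/(inrZ (i.+1%:R * - c)^-1); rewrite /F scalerA.
have -> : (lift ord0 i - i = 1)%N by rewrite /= /bump; lia.
by rewrite expr1 /= /bump add1n binSn mulVf ?scale1r.
Qed.

(** Match q - 1 of the variables with the nontrivial elements g of E, and write
    each of them as g(u_g) - u_g. *)
Lemma prod_var_in_hilbert_ideal (t : seq 'I_m) : (1 < q)%N -> (q.-1 <= size t)%N ->
  hilbert_ideal (\prod_(j <- t) 'X_(lift ord0 j)).
Proof.
move=> q1 szt; rewrite -(cat_take_drop q.-1 t) big_cat.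
apply: hilbert_ideal_mulr; set t' := take _ _.
have szt' : size t' = q.-1 by rewrite size_takel.
have [j0 _] : exists j0 : 'I_m, j0 \in t'.
  case: t' szt' => [|j s]; last by move=> _; exists j; rewrite inE eqxx.
  by move: q1 => /[swap]; case: #|E| => [|[]].
(* The variable at position idx g of the list is matched with g. *)
pose idx g := index g (enum (E^#)%g).
have [g | u hu] := @fin_all_exists gT (fun=> S) (fun g u => u \is 1.-homog /\
   (g \in (E^#)%g -> shear_act (a g) u - u = 'X_(lift ord0 (nth j0 t' (idx g))))).
  have [/setD1P[g1 Eg] | _] := boolP (g \in (E^#)%g); last by exists 0; rewrite rpred0.
  have [|u hu uE] := @var_in_range (a g) (nth j0 t' (idx g)).
    by rewrite (additive_char_eq0 aM a_inj).
  by exists u.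
have -> : \prod_(j <- t') 'X_(lift ord0 j) =
  \prod_(g <- enum (E^#)%g) (shear_act (a g) (u g) - u g).
  rewrite (big_nth j0) [RHS](big_nth 1%g) szt' card_nontriv.
  rewrite !big_nat; apply: eq_bigr => i /andP[_ iq].
  have isz : (i < size (enum (E^#)%g))%N by rewrite card_nontriv.
  rewrite (hu _).2; first by rewrite /idx index_uniq ?enum_uniq.
  by rewrite -mem_enum mem_nth.
by apply: prod_diff_in_hilbert_ideal => g; have [] := hu g.
Qed.

Lemma shear_actX0 c :
  shear_act c ('X_ord0 : S) = 'X_ord0 + \sum_(j < m) (- c) ^+ j.+1 *: 'X_(lift ord0 j).
Proof.
rewrite shear_actX big_ord_recl /= bin0 mul1r expr0 scale1r; congr (_ + _).
by apply: eq_bigr => j _; rewrite bin0 mul1r.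
Qed.

(** Write a factor X_0 as g(X_0), for an element g not used so far, minus a
    combination of the other variables, and continue with both parts. In the
    end either the conjugates of X_0 make up the norm, or there are at most
    q - 1 of them, which leaves at least q - 1 other variables. *)
Lemma list_in_hilbert_ideal n (gs gs' : seq gT) (t : seq 'I_m) : (1 < q)%N ->
    enum E = gs ++ gs' -> (2 * q - 2 <= size gs + n + size t)%N ->
  hilbert_ideal (\prod_(g <- gs) shear_act (a g) 'X_ord0 *
                 ('X_ord0 ^+ n * \prod_(j <- t) 'X_(lift ord0 j))).
Proof.
move=> q1; elim: n gs gs' t => [|n IH] gs [|g gs'] t Egs hsz.
- apply: hilbert_ideal_mulr; move: Egs; rewrite cats0 => <-.
  by rewrite big_enum; apply: hilbert_ideal_norm.
- rewrite mulrA; apply/hilbert_ideal_mull/prod_var_in_hilbert_ideal => //.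
  have /(congr1 size) := Egs; rewrite -cardE size_cat /=.
  move: hsz; rewrite addn0; move: (size gs) (size gs') (size t) #|E| => x y z w. lia.
- apply: hilbert_ideal_mulr; move: Egs; rewrite cats0 => <-.
  by rewrite big_enum; apply: hilbert_ideal_norm.
pose P := \prod_(g <- gs) shear_act (a g) ('X_ord0 : S).
have -> : P * ('X_ord0 ^+ n.+1 * \prod_(j <- t) 'X_(lift ord0 j)) =
    P * shear_act (a g) 'X_ord0 * ('X_ord0 ^+ n * \prod_(j <- t) 'X_(lift ord0 j)) -
    \sum_(j < m) (- a g) ^+ j.+1 *:
       (P * ('X_ord0 ^+ n * \prod_(i <- j :: t) 'X_(lift ord0 i))).
  rewrite [X in _ - X](eq_bigr (fun j : 'I_m => (- a g) ^+ j.+1 *: 'X_(lift ord0 j) *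
    (P * ('X_ord0 ^+ n * \prod_(i <- t) 'X_(lift ord0 i))))) => [|j _]; last first.
    by rewrite big_cons -scalerAl; congr (_ *: _); ring.
  rewrite -mulr_suml shear_actX0 exprS; ring.
apply: hilbert_idealB; last first.
  apply: hilbert_ideal_sum => j _; apply/hilbert_idealZ/(IH _ (g :: gs')) => //=.
  by apply: leq_trans hsz _; rewrite !addnS !addSn leqnn.
have -> : P * shear_act (a g) 'X_ord0 =
    \prod_(h <- rcons gs g) shear_act (a h) ('X_ord0 : S).
  by rewrite -cats1 big_cat big_seq1.
apply: (IH _ gs'); first by rewrite cat_rcons.
by rewrite size_rcons (leq_trans hsz) // addnS addSn.
Qed.

Lemma monomial_in_hilbert_ideal (mu : 'X_{1..m.+1}) : (1 < q)%N ->
  (2 * q - 2 <= mdeg mu)%N -> hilbert_ideal 'X_[mu].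
Proof.
move=> q1; rewrite mdegE big_ord_recl mpolyXE_id big_ord_recl => hsz.
pose t := flatten [seq nseq (mu (lift ord0 j)) j | j <- index_enum 'I_m].
have -> : \prod_(j < m) 'X_(lift ord0 j) ^+ mu (lift ord0 j) =
  \prod_(j <- t) 'X_(lift ord0 j) :> S.
  rewrite big_flatten big_map; apply: eq_bigr => j _.
  by rewrite big_nseq iter_mulr_1.
have szt : size t = \sum_(j < m) mu (lift ord0 j).
  rewrite size_flatten sumnE !big_map; apply: eq_bigr => j _.
  by rewrite size_nseq.
have := @list_in_hilbert_ideal (mu ord0) [::] (enum E) t q1 (erefl _).
by rewrite big_nil mul1r /= add0n szt; apply.
Qed.

Lemma homog_in_hilbert_ideal d h : (1 < q)%N ->
  (2 * q - 2 <= d)%N -> h \is d.-homog -> hilbert_ideal h.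
Proof.
move=> q1 qd hh; rewrite [h]mpolyE big_seq; apply: hilbert_ideal_sum => mu hmu.
apply/hilbert_idealZ/monomial_in_hilbert_ideal => //.
by rewrite (dhomog_mf hh hmu : mdeg mu = d).
Qed.

Lemma pihomogM_homog c e d f : c \is e.-homog ->
  pihomog mdeg d (c * f) = if (e <= d)%N then c * pihomog mdeg (d - e) f else 0.
Proof.
move=> hc; rewrite {1}(pihomog_partitionE (leqnn (msize f))) mulr_sumr linear_sum /=.
have hi i : c * pihomog mdeg i f \is (e + i).-homog by rewrite dhomogM ?pihomogP.
case: leqP => [ed | de]; last first.
  by apply: big1 => i _; apply: pihomog_ne0 (hi i); lia.
have [lt | le] := ltnP (d - e) (msize f).
  rewrite (bigD1 (Ordinal lt)) //= big1 => [|i ne].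
    by rewrite addr0 pihomog_dE //= -{2}(subnKC ed).
  apply: pihomog_ne0 (hi i); apply: contra_neq ne => ed'.
  by apply: val_inj; rewrite /= -ed' addKn.
rewrite [pihomog _ (d - e) f](_ : _ = 0) ?mulr0 ?big1 // => [i _|].
  by apply: pihomog_ne0 (hi i); have := ltn_ord i; lia.
rewrite pihomogE big_seq_cond big1 // => mu /andP[fmu /eqP hmu].
by have := msize_mdeg_lt fmu; rewrite hmu ltnNge le.
Qed.

Lemma pihomog_act c d f : pihomog mdeg d (shear_act c f) = shear_act c (pihomog mdeg d f).
Proof.
elim/mpolyind: f => [|b mu f _ _ IH]; first by rewrite !linear0.
rewrite !linearP /= {}IH pihomogX; congr (_ *: _ + _).
have hmu : shear_act c 'X_[mu] \is (mdeg mu).-homog by rewrite shear_act_homog // dhomogX.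
case: eqP => [<- | /eqP ne]; first by rewrite pihomog_dE.
by rewrite linear0 (pihomog_ne0 ne hmu).
Qed.

Local Notation alg := (in_alg_span (fun f => fixed f /\ (msize f <= (2 * q - 3).+1)%N)).

Lemma alg_sum (A : algType k) (P : A -> Prop) (I : Type) (r : seq I) (Q : pred I)
    (F : I -> A) :
  (forall i, Q i -> in_alg_span P (F i)) -> in_alg_span P (\sum_(i <- r | Q i) F i).
Proof.
move=> hF; apply: big_ind => //; last exact: AlgSpanAdd.
by rewrite -(scale0r 1); apply: AlgSpanScalar.
Qed.

(** For an invariant c of positive degree at most q < d, both factors of
    tr(c f) = c tr(f) have degree less than d. *)
Lemma trace_hilbert_ideal d h :
    (2 < q)%N ->
    (forall e f, (e < d)%N -> f \is e.-homog -> fixed f -> alg f) ->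
  (q < d)%N -> hilbert_ideal h -> alg (tr (pihomog mdeg d h)).
Proof.
move=> q2 IH qd; elim=> [c f e fc hc he | f1 f2 _ IH1 _ IH2]; last first.
  by rewrite !linearD; apply: AlgSpanAdd.
rewrite (pihomogM_homog _ _ hc); case: leqP => [ed | _]; last first.
  by rewrite linear0 -(scale0r 1); apply: AlgSpanScalar.
rewrite trace_mull //; apply: AlgSpanMul; first by apply: IH hc _ => //; lia.
apply: (IH (d - e)%N); first by lia.
  exact/trace_homog/pihomogP.
exact: trace_fixed.
Qed.

Lemma homog_fixed_generated d f : (2 < q)%N -> f \is d.-homog -> fixed f -> alg f.
Proof.
move=> q2; have [n] := ubnP d; elim: n d f => // n IH d f dn hf fixf.
have IHd e h : (e < d)%N -> h \is e.-homog -> fixed h -> alg h.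
  by move=> ed; apply: IH; lia.
have [small | big] := leqP d (2 * q - 3).
  by apply: AlgSpanGen; split=> //; apply: leq_trans (msize_homog hf) _.
have [|g [h [hg fg hh ->]]] := fixed_norm_trace aM a_inj m_unit _ hf fixf; first by lia.
apply: AlgSpanAdd.
  apply: AlgSpanMul; first by apply: IHd (norm_homog E a m) (norm_fixed aM m); lia.
  by apply: IHd hg fg; lia.
rewrite -(pihomog_dE hh); apply: trace_hilbert_ideal => //; first by lia.
by apply: homog_in_hilbert_ideal hh; lia.
Qed.

Lemma fixed_generated f : (2 < q)%N -> fixed f -> alg f.
Proof.
move=> q2 fixf; rewrite (pihomog_partitionE (leqnn (msize f))).
apply: alg_sum => d _; apply: homog_fixed_generated (pihomogP _ _ _) _ => //.
by move=> g Eg; rewrite -pihomog_act fixf.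
Qed.

End HilbertIdeal.

(** For q = 2 and m = 0: the norm has degree q > 2q - 3, but X_0 itself is
    invariant. *)
Lemma one_var_generated (k : fieldType) (P : {mpoly k[1]} -> Prop) f :
  P 'X_ord0 -> in_alg_span P f.
Proof.
move=> PX; rewrite [f]mpolyE; apply: alg_sum => mu _.
rewrite -mul_mpolyC -alg_mpolyC; apply: AlgSpanMul (AlgSpanScalar _ _) _.
rewrite mpolyXE_id big_ord1; elim: (mu _) => [|n IH].
  by rewrite expr0 -(scale1r 1); apply: AlgSpanScalar.
by rewrite exprS; apply: AlgSpanMul IH; apply: AlgSpanGen.
Qed.

(** * Symmetric powers, the unipotent form of W, and transport *)

Section SymmetricPowerFunctor.

Variables (k : fieldType) (m : nat).
Implicit Types (A B : 'M[k]_2).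

(** sym_power as a functor on all square matrices, so that it can be applied to
    the change of basis of W. *)
Definition sym_mx A : 'M[k]_m.+1 :=
  \matrix_(i, j) (lin_subst A 'X_[sym_mon i])@_(sym_mon j).

Lemma sym_mx_row A (i : 'I_m.+1) :
  \sum_j sym_mx A i j *: 'X_[sym_mon j] = lin_subst A 'X_[sym_mon i].
Proof.
rewrite [RHS](@sym_monE _ m); last by rewrite lin_subst_homog // dhomogX /= sym_mon_mdeg.
by apply: eq_bigr => j _; rewrite mxE.
Qed.

Lemma coef_sym_mon (b : 'I_m.+1 -> k) j :
  (\sum_l b l *: 'X_[sym_mon l])@_(sym_mon j) = b j.
Proof.
rewrite linear_sum (bigD1 j) //= mcoeffZ mcoeffX eqxx mulr1 big1 ?addr0 // => l ne.
rewrite mcoeffZ mcoeffX sym_monP ?sym_mon_mdeg // mnmE /=.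
by rewrite val_eqE (negPf ne) mulr0.
Qed.

Lemma sym_mx1 : sym_mx 1%:M = 1%:M.
Proof.
apply/matrixP => i j; rewrite !mxE lin_subst1 mcoeffX.
by rewrite sym_monP ?sym_mon_mdeg // mnmE.
Qed.

Lemma sym_mxM A B : sym_mx (A *m B) = sym_mx A *m sym_mx B.
Proof.
apply/matrixP => i j; rewrite [LHS]mxE lin_substM -sym_mx_row.
rewrite {1}/lin_subst (raddf_sum (comp_mpoly _)) raddf_sum /= mxE.
apply: eq_bigr => l _; rewrite (comp_mpolyZ (sym_mx A i l)) mcoeffZ; congr (_ * _).
by rewrite mxE.
Qed.

Definition shear (c : k) : 'M[k]_2 := 1%:M + c *: delta_mx ord_max ord0.

Lemma sym_monX (i : 'I_m.+1) :
  'X_[sym_mon i] = 'X_ord0 ^+ (m - i) * 'X_ord_max ^+ i :> {mpoly k[2]}.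
Proof.
rewrite mpolyXE_id !big_ord_recl big_ord0 mulr1 !mnmE /=.
by congr (_ * 'X__ ^+ _); apply: val_inj.
Qed.

Lemma lin_subst_shear c (i : 'I_m.+1) : lin_subst (shear c) 'X_[sym_mon i] =
  'X_ord0 ^+ (m - i) * (c *: 'X_ord0 + 'X_ord_max) ^+ i.
Proof.
rewrite sym_monX /lin_subst rmorphM !rmorphXn /= !comp_mpolyXU -!tnth_nth.
have e1 : lift ord0 ord0 = ord_max :> 'I_2 by apply: val_inj.
rewrite !tnth_mktuple !big_ord_recl !big_ord0 !addr0 !mxE !e1 /=.
by rewrite !(mulr0, mulr1, addr0, add0r, scale0r, scale1r).
Qed.

Lemma sym_mx_shear c i j :
  sym_mx (shear c) i j = 'C(i, j)%:R * c ^+ (i - j).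
Proof.
rewrite mxE -[RHS](coef_sym_mon (fun l => 'C(i, l)%:R * c ^+ (i - l))).
congr (_@__); rewrite lin_subst_shear exprDn mulr_sumr.
pose F l : {mpoly k[2]} := 'X_ord0 ^+ (m - i) *
  ((c *: 'X_ord0) ^+ (i - l) * 'X_ord_max ^+ l *+ 'C(i, l)).
rewrite (big_ord_widen m.+1 F) // big_mkcond; apply: eq_bigr => l _.
case: ltnP => li; last by rewrite bin_small // mul0r scale0r.
rewrite /F sym_monX exprZn -scaler_nat -!scalerAl -!scalerAr scalerA mulrA.
by rewrite -exprD; congr (_ *: ('X_ord0 ^+ _ * _)); have := ltn_ord i; lia.
Qed.

Lemma sym_mx_shearN c : (sym_mx (shear (- c)))^T = binomial_mx m c.
Proof. by apply/matrixP => i j; rewrite [LHS]mxE sym_mx_shear [RHS]mxE. Qed.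

End SymmetricPowerFunctor.

Section UnipotentForm.

Variables (k : fieldType) (gT : finGroupType) (E : {group gT}) (p : nat).
Hypothesis p_prime : prime p.
Hypothesis E_abelem : (p.-abelem E)%g.
Hypothesis k_char : p \in [pchar k].
Variable W : mx_representation k E 2.

Lemma mx2_eq (A B : 'M[k]_2) : (forall j, A ord0 j = B ord0 j) ->
  (forall j, A ord_max j = B ord_max j) -> A = B.
Proof.
move=> e0 e1; apply/matrixP => i j; case: (unliftP ord0 i) => [l -> | -> //].
by rewrite (_ : lift ord0 l = ord_max) //; apply: val_inj; case: l => [[]].
Qed.

Lemma mulmx2E (A B : 'M[k]_2) i j :
  (A *m B) i j = A i ord0 * B ord0 j + A i ord_max * B ord_max j.
Proof.
rewrite mxE !big_ord_recl big_ord0 addr0.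
by congr (_ + A i _ * B _ j); apply: val_inj.
Qed.

Lemma shearE c i j : shear c i j =
  if i == j then 1 else if i == ord_max then c else 0 :> k.
Proof.
rewrite !mxE; case: i => [[|[|//]] hi]; case: j => [[|[|//]] hj] /=;
by rewrite ?(mulr0, mulr1, addr0, add0r).
Qed.

Lemma adapted_basis (w : 'rV[k]_2) : w != 0 ->
  exists P : 'M[k]_2, exists c, P \in unitmx /\ row ord0 P = c *: w.
Proof.
move=> w0; pose b := col_ebase w 0 0; exists (row_ebase w), b^-1.
split; first exact: row_ebase_unit.
have e : b *: row ord0 (row_ebase w) = w.
  rewrite -[RHS]mulmx_ebase rank_rV w0 (mx11_scalar (col_ebase w)) -/b.
  rewrite -mulmxA mul_scalar_mx rowE; congr (_ *: (_ *m _)).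
  by apply/matrixP => i j; rewrite !mxE (ord1 i) andbT; case: j => [[]].
have b0 : b != 0 by apply: contraNneq w0 => b0; rewrite -e b0 scale0r.
by rewrite -[in RHS]e scalerA mulVf ?scale1r.
Qed.

Lemma root_of_unity_pchar (x : k) : x ^+ p = 1 -> x = 1.
Proof.
move=> xp; apply: (fmorph_inj (pFrobenius_aut k_char)).
by rewrite rmorph1; exact: xp.
Qed.

(** The p-group E fixes a nonzero vector. In a basis that starts with it, the
    action is lower triangular with a first diagonal entry 1; the other one is
    a character with values in the p-th roots of unity, so it is 1 as well. *)
Lemma unipotent_form : exists P : 'M[k]_2, exists a : gT -> k,
  [/\ P \in unitmx, {in E &, {morph a : g h / (g * h)%g >-> g + h}} &
      {in E, forall g, W g = invmx P *m shear (a g) *m P}].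
Proof.
have [pE _ _] := and3P E_abelem.
have fix0 : rfix_mx W E != 0 by apply: (rfix_pgroup_pchar k_char).
pose w := nz_row (rfix_mx W E).
have w0 : w != 0 by rewrite nz_row_eq0.
have wW g : g \in E -> w *m W g = w by apply/rfix_mxP/nz_row_sub.
have [P [c [Pu Pw]]] := adapted_basis w0; pose T g := P *m W g *m invmx P.
have TM g h : g \in E -> h \in E -> T (g * h)%g = T g *m T h.
  by move=> Eg Eh; rewrite /T repr_mxM // !mulmxA mulmxKV.
have T0 g j : g \in E -> T g ord0 j = (j == ord0)%:R.
  move=> Eg; have : row ord0 (T g) = row ord0 1%:M.
    by rewrite !row_mul Pw -scalemxAl wW // -Pw -row_mul mulmxV.
  by move/rowP/(_ j); rewrite !mxE eq_sym.
have chiM g h : g \in E -> h \in E ->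
    T (g * h)%g ord_max ord_max = T g ord_max ord_max * T h ord_max ord_max.
  by move=> Eg Eh; rewrite TM // mulmx2E T0 // mulr0 add0r.
have chi1 g : g \in E -> T g ord_max ord_max = 1.
  move=> Eg; apply: root_of_unity_pchar.
  have chiX n : T (g ^+ n)%g ord_max ord_max = T g ord_max ord_max ^+ n.
    elim: n => [|n IH]; first by rewrite expg0 /T repr_mx1 mulmx1 mulmxV // mxE.
    by rewrite expgS exprS chiM ?groupX // IH.
  have [_ /(_ g Eg) gp] := abelemP p_prime E_abelem.
  by rewrite -chiX gp /T repr_mx1 mulmx1 mulmxV // mxE.
exists P, (fun g => T g ord_max ord0); split=> // [g h Eg Eh | g Eg].
  by rewrite TM // mulmx2E T0 // chi1 // mulr1 mul1r.
have -> : shear (T g ord_max ord0) = T g.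
  apply: mx2_eq => j; rewrite shearE; first by rewrite T0 // eq_sym; case: eqP.
  rewrite eqxx eq_sym; have [-> | ne] := eqVneq j ord_max; first by rewrite chi1.
  by congr (T g _ _); apply: val_inj; case: j ne => [[|[|//]] hj].
by rewrite /T !mulmxA mulVmx // mul1mx mulmxKV.
Qed.

Lemma trivial_decomposable : E :=: 1%g -> ~ mx_indecomposable W.
Proof.
pose U : 'M[k]_2 := delta_mx ord0 ord0; pose V : 'M[k]_2 := delta_mx ord_max ord_max.
move=> E1 [_ /(_ U V)].
have mod1 (A : 'M[k]_2) : mxmodule W A.
  apply/mxmoduleP => g Eg; have /set1P -> : g \in [1 gT]%g by rewrite -E1.
  by rewrite repr_mx1 mulmx1.
have sum1 : U + V = 1%:M.
  apply/matrixP => i j; rewrite !mxE.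
  by case: i => [[|[|//]] hi]; case: j => [[|[|//]] hj]; rewrite /= ?addr0 ?add0r.
have full : (U + V :=: 1%:M)%MS.
  by apply/eqmxP; rewrite submx1 -sum1 addmx_sub_adds.
have cap0 : (U :&: V)%MS = 0.
  apply/eqP; rewrite -mxrank_eq0; have := mxrank_sum_cap U V.
  by rewrite full mxrank1 !mxrank_delta => /(@addnI 2 _ 0) ->.
move=> /(_ (mod1 _) (mod1 _) full cap0) [] /matrixP.
  by move/(_ ord0 ord0)/eqP; rewrite !mxE oner_eq0.
by move/(_ ord_max ord_max)/eqP; rewrite !mxE oner_eq0.
Qed.

End UnipotentForm.

Section Transport.

Variables (k : fieldType) (n : nat).
Implicit Types (f : {mpoly k[n]}) (A B M : 'M[k]_n).

Lemma lin_substK A B : A *m B = 1%:M -> cancel (lin_subst A) (lin_subst B).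
Proof. by move=> AB f; rewrite -lin_substM AB lin_subst1. Qed.

Lemma lin_subst_conj A B M f : A *m B = 1%:M ->
  lin_subst (B *m M *m A)^T (lin_subst B^T f) = lin_subst B^T (lin_subst M^T f).
Proof.
move=> AB; rewrite !trmx_mul -!lin_substM !mulmxA -(trmx_mul A B) AB trmx1.
by rewrite mul1mx.
Qed.

Lemma msize_lin_subst A f : (msize (lin_subst A f) <= msize f)%N.
Proof.
rewrite {1}(pihomog_partitionE (leqnn (msize f))) /lin_subst raddf_sum /=.
apply: leq_trans (msize_sum _ _ _) _; apply/bigmax_leqP => d _.
apply: leq_trans (ltn_ord d).
exact/msize_homog/lin_subst_homog/pihomogP.
Qed.

Lemma in_alg_span_morph (A B : algType k) (phi : {lrmorphism A -> B})
    (P : A -> Prop) (Q : B -> Prop) x :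
  (forall y, P y -> Q (phi y)) -> in_alg_span P x -> in_alg_span Q (phi x).
Proof.
move=> PQ; elim=> [y /PQ | c | y z _ IHy _ IHz | y z _ IHy _ IHz].
- exact: AlgSpanGen.
- by rewrite rmorph_alg; apply: AlgSpanScalar.
- by rewrite rmorphD; apply: AlgSpanAdd.
by rewrite rmorphM; apply: AlgSpanMul.
Qed.

Lemma fixed_generated_conj (T : Type) (D : T -> Prop) (A : algType k)
    (act1 act2 : T -> A -> A) (small : A -> Prop)
    (phi : {lrmorphism A -> A}) (psi : A -> A) :
    cancel phi psi -> cancel psi phi ->
    (forall g x, D g -> act1 g (phi x) = phi (act2 g x)) ->
    (forall x, small x -> small (phi x)) ->
    (forall x, (forall g, D g -> act2 g x = x) ->
      in_alg_span (fun y => (forall g, D g -> act2 g y = y) /\ small y) x) ->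
  forall x, (forall g, D g -> act1 g x = x) ->
    in_alg_span (fun y => (forall g, D g -> act1 g y = y) /\ small y) x.
Proof.
move=> phiK psiK actE small_phi gen x fixx; rewrite -(psiK x).
apply: in_alg_span_morph (gen _ _) => [y [fixy szy] | g Dg].
  by split=> [g Dg|]; [rewrite actE // fixy | apply: small_phi].
by apply: (can_inj phiK); rewrite -actE // psiK fixx.
Qed.

End Transport.

Lemma poly_act_shear (k : fieldType) (gT : finGroupType) (E : {group gT})
    (W : mx_representation k E 2) (m : nat) (P : 'M[k]_2) (c : k) g f :
    P \in unitmx -> W g^-1%g = invmx P *m shear (- c) *m P ->
  poly_act (sym_power m W) g (lin_subst (sym_mx m (invmx P))^T f) =
  lin_subst (sym_mx m (invmx P))^T (shear_act c f).
Proof.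
move=> Pu Wg; have PQ : sym_mx m P *m sym_mx m (invmx P) = 1%:M.
  by rewrite -sym_mxM mulmxV // sym_mx1.
have rE : sym_power m W g^-1%g =
    sym_mx m (invmx P) *m sym_mx m (shear (- c)) *m sym_mx m P.
  by rewrite -(sym_mxM m (invmx P)) -(sym_mxM m (_ *m _)) -Wg.
rewrite /poly_act rE /shear_act -sym_mx_shearN.
move: (sym_mx m P) (sym_mx m (invmx P)) (sym_mx m (shear (- c))) PQ => A B M.
exact: lin_subst_conj.
Qed.

Theorem theorem1p1 (p : nat) (p_prime : prime p)
    (gT : finGroupType) (E : {group gT}) (E_abelem : (p.-abelem E)%g)
    (q : nat) (E_order : #|E| = q)
    (k : fieldType) (k_infinite : forall s : seq k, exists x : k, x \notin s)
    (k_char : p \in [pchar k])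
    (W : mx_representation k E 2)
    (W_faithful : mx_faithful W) (W_indec : mx_indecomposable W)
    (m : nat) (m_lt_p : (m < p)%N)
    (qm_neq : ~ (q = 2%N /\ m = 1%N)) :
  generated_as_algebra (invariant (sym_power m W))
    (invariant_deg_le (sym_power m W) (2 * q - 3)%N).
Proof.
move=> f; split; last first.
  elim=> [g [] // | c | g h _ IHg _ IHh | g h _ IHg _ IHh] x Ex.
  - by rewrite /poly_act /lin_subst rmorph_alg.
  - exact: etrans (rmorphD (comp_mpoly _) g h) (congr2 +%R (IHg x Ex) (IHh x Ex)).
  exact: etrans (rmorphM (comp_mpoly _) g h) (congr2 *%R (IHg x Ex) (IHh x Ex)).
move=> invf.
have [P [a [Pu aM WE]]] := unipotent_form p_prime E_abelem k_char W.
have a_inj : {in E &, injective a}.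
  by move=> g h Eg Eh e; apply: (mx_faithful_inj W_faithful) => //; rewrite !WE ?e.
have q1 : (1 < q)%N.
  rewrite -E_order ltnNge; apply/negP => E1.
  by apply: trivial_decomposable W_indec; apply: card_le1_trivg.
have pq : (p %| q)%N.
  have [pE _ _] := and3P E_abelem.
  have [|_ + _] := pgroup_pdiv pE; last by rewrite E_order.
  by rewrite -cardG_gt1 E_order.
have card0 : #|E|%:R = 0 :> k by apply/eqP; rewrite E_order -(dvdn_pcharf k_char).
have m_unit : m`!%:R != 0 :> k.
  rewrite -(dvdn_pcharf k_char); elim: m m_lt_p {qm_neq f invf} => [|n IH] np.
    by rewrite fact0 dvdn1 neq_ltn prime_gt1 ?orbT.
  rewrite factS Euclid_dvdM // negb_or IH ?(ltnW np) // andbT.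
  by rewrite gtnNdvd.
have PQ : sym_mx m P *m sym_mx m (invmx P) = 1%:M.
  by rewrite -sym_mxM mulmxV // sym_mx1.
have QP : sym_mx m (invmx P) *m sym_mx m P = 1%:M.
  by rewrite -sym_mxM mulVmx // sym_mx1.
have actE g h : g \in E -> poly_act (sym_power m W) g
    (lin_subst (sym_mx m (invmx P))^T h) =
    lin_subst (sym_mx m (invmx P))^T (shear_act (a g) h).
  by move=> Eg; apply: poly_act_shear; rewrite // WE ?groupV // (additive_charV aM).
move: (sym_mx m P) (sym_mx m (invmx P)) PQ QP actE => A B PQ QP actE.
apply: (@fixed_generated_conj _ _ (fun g => g \in E) _ _ (fun g => shear_act (a g))
  (fun h => msize h <= (2 * q - 3).+1)%N
  (comp_mpoly [tuple \sum_(j < m.+1) B^T i j *: 'X_j | i < m.+1])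
  (lin_subst A^T)) => //.
- by apply: (@lin_substK _ _ B^T); rewrite -trmx_mul PQ trmx1.
- by apply: (@lin_substK _ _ A^T); rewrite -trmx_mul QP trmx1.
- by move=> h; apply: leq_trans; apply: (msize_lin_subst B^T).
rewrite -E_order => h; have [q2 | q2] := ltnP 2 #|E|; first exact: fixed_generated.
(* As q = 2 is divisible by p > m, the number m is 0 or 1, and 1 is excluded. *)
have {}q2 : q = 2%N by apply/eqP; rewrite eqn_leq q1 -E_order q2.
have m0 : m = 0%N.
  have : (m < 2)%N by rewrite (leq_trans m_lt_p) // -q2 dvdn_leq // q2.
  by case: (m) qm_neq => [|[|]] // [].
(* Eliminating the equation m = 0 puts h in a ring of type {mpoly k[1]}. *)
rewrite E_order q2 => _; case: _ / (esym m0) h.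
move=> h; apply: one_var_generated; split; last by rewrite msizeX mdeg1.
by move=> g _; rewrite shear_actX0 big_ord0 addr0.
Qed.
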